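(* Let $\mathbb{G}$ be a stratified group equipped with a homogeneous distance $d$ and let $\mathbb{M}$ be a Banach homogeneous group equipped with its Banach homogeneous distance $\rho$. Let $A\subset\mathbb{G}$ be measurable, let $f\colon A\to\mathbb{M}$ be Lipschitz and let $x\in A\cap D(A)$. Then $f$ is (h-)differentiable at $x$ if and only if both of the following properties hold: 1. $f$ is differentiable at $x$ in every direction $\zeta\in\mathbb{G}\setminus\{0\}$; 2. the mapping $\mathbb{G}\ni\zeta\mapsto\partial^+f(x,\zeta)\in\mathbb{M}$ is a homogeneous homomorphism.
   Context: **Banach homogeneous groups.** A Banach Lie algebra is a (real) Banach space $\mathbb{M}$ with norm $|\cdot|$ and a continuous, bilinear, skew-symmetric bracket $[\cdot,\cdot]$ satisfying the Jacobi identity. It is nilpotent of step $\nu\in\mathbb{N}$ if all iterated left-nested brackets of $\nu+1$ elements vanish and some iterated left-nested bracket of $\nu$ elements is nonzero. It carries the group operation $xy=x+y+\sum_{m=2}^{\nu}P_m(x,y)$ given by the truncated Baker-Campbell-Hausdorff series ($P_m$ is the homogeneous term of degree $m$, written with iterated brackets; e.g. $P_2(x,y)=[x,y]/2$); the identity is $0$ and $x^{-1}=-x$. $\mathbb{M}$ is a Banach homogeneous group if there are closed subspaces $H_1,\dots,H_\nu$ with $\mathbb{M}=H_1\oplus\cdots\oplus H_\nu$ (the sum map $H_1\times\cdots\times H_\nu\to\mathbb{M}$ is a continuous linear bijection), $[x,y]\in H_{i+j}$ for $x\in H_i,y\in H_j$, $i+j\le\nu$, and $[x,y]=0$ if $i+j>\nu$.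 Let $\pi_i\colon\mathbb{M}\to H_i$ be the projections. Dilations $\delta_r$, $r>0$, are the linear maps acting as multiplication by $r^i$ on $H_i$. Fixed positive constants $\sigma_1=1,\sigma_2,\dots,\sigma_\nu$ are chosen so that the Banach homogeneous norm $\|x\|=\max_{1\le i\le\nu}\sigma_i|\pi_i(x)|^{1/i}$ satisfies $\|xy\|\le\|x\|+\|y\|$ (such constants exist); the Banach homogeneous distance is $\rho(x,y)=\|x^{-1}y\|$. **Stratified groups.** A stratified group $\mathbb{G}$ is a finite dimensional Banach homogeneous group, with layers $\mathbb{G}=V_1\oplus\cdots\oplus V_s$, such that $[V_1,V_j]=V_{j+1}$ for $j\ge1$ and $V_j=\{0\}$ for $j>s$. A homogeneous distance $d$ on $\mathbb{G}$ is a distance with $d(zx,zy)=d(x,y)$ and $d(\delta_rx,\delta_ry)=r\,d(x,y)$ for all $x,y,z\in\mathbb{G}$, $r>0$; write $d(x)=d(x,0)$. $\mu$ denotes a Haar measure on $\mathbb{G}$. ''Measurable'' refers to $\mu$, and ''Lipschitz'' refers to $d$ and $\rho$. **Density points.** $D(A)$ is the set of $x\in\mathbb{G}$ with $\lim_{r\downarrow0}\mu(A\cap B(x,r))/\mu(B(x,r))=1$, where $B(x,r)$ is the open $d$-ball. **Directional derivatives.** Points $\zeta_x^t\in\mathbb{G}$, $t>0$, approximate in $A$ the direction $\zeta\in\mathbb{G}$ at $x$ if $x\zeta_x^t\in A$ for every $t>0$ and $d(\zeta_x^t,\delta_t\zeta)/t\to0$ as $t\downarrow0$. Let $f\colon A\to\mathbb{M}$,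 $x\in A$, and suppose there exist points approximating in $A$ the direction $\zeta$ at $x$. Then $f$ is differentiable at $x$ in direction $\zeta$, with directional derivative $\partial^+f(x,\zeta)\in\mathbb{M}$, if for every choice $t\mapsto\zeta_x^t$ of points approximating in $A$ the direction $\zeta$ at $x$ one has $\lim_{t\downarrow0}\delta_{1/t}\big(f(x)^{-1}f(x\zeta_x^t)\big)=\partial^+f(x,\zeta)$. The same definition is used for $\zeta=0$. **Homogeneous homomorphisms and differentiability.** A homogeneous homomorphism (h-homomorphism) is a map $L\colon\mathbb{G}\to\mathbb{M}$ with $L(xy)=L(x)L(y)$ and $L(\delta_rx)=\delta_r(L(x))$ for all $x,y\in\mathbb{G}$, $r>0$. For $x\in A\cap D(A)$, $f\colon A\to\mathbb{M}$ is h-differentiable (or simply differentiable) at $x$ if there is an h-homomorphism $L\colon\mathbb{G}\to\mathbb{M}$ with $\rho(f(x)^{-1}f(xz),L(z))/d(z)\to0$ as $z\in x^{-1}A$, $d(z)\downarrow0$. *)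

(* Defs.v *)
From HB Require Import structures.
From mathcomp Require Import all_boot all_order all_algebra.
From mathcomp Require Import all_classical all_reals all_analysis.
Set Implicit Arguments.
Unset Strict Implicit.
Unset Printing Implicit Defensive.
Import Order.TTheory GRing.Theory Num.Theory.
Import numFieldNormedType.Exports.
Local Open Scope classical_set_scope.
Local Open Scope ring_scope.

Record banachLieAlgebra (R : realType) := BanachLieAlgebra {
  lie_space :> completeNormedModType R;
  lie_bracket : {bilinear lie_space -> lie_space -> lie_space};
  lie_bracket_continuous :
    continuous (fun p : lie_space * lie_space => lie_bracket p.1 p.2);
  lie_bracket_skew : forall x y, lie_bracket x y = - lie_bracket y x;
  lie_jacobi : forall x y z,
    lie_bracket x (lie_bracket y z) + lie_bracket y (lie_bracket z x)
    + lie_bracket z (lie_bracket x y) = 0 }.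

Reserved Notation "[| x , y |]" (format "[|  x ,  y  |]").
Notation "[| x , y |]" := (lie_bracket _ x y) : ring_scope.

Section Lie.
Context {R : realType} {M : banachLieAlgebra R}.
Implicit Types (x y : M) (s : seq M).

(* [:: x1; x2; ...; xn] |-> [[...[x1, x2], ...], xn]; a single letter is its
   own bracket. *)
Definition iterated_bracket s : M :=
  if s is x :: s' then foldl (fun u v => [| u, v |]) x s' else 0.

(* As iterated_bracket [::] = 0, this forces 0 < nu. *)
Definition nilpotent_of_step (nu : nat) : Prop :=
  (forall s, size s = nu.+1 -> iterated_bracket s = 0) /\
  (exists2 s, size s = nu & iterated_bracket s != 0).

(* Dynkin's form of the homogeneous term of degree m of log (exp x exp y):
   the sum over k >= 1 and over (p_i, q_i), i < k, with p_i + q_i > 0 and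
   \sum_i (p_i + q_i) = m, of
     (-1)^(k-1) / (k m \prod_i p_i! q_i!) [x^p_1 y^q_1 ... x^p_k y^q_k],
   where [w] is the left-nested bracket of the letters of the word w. *)
Definition bch_term (m : nat) x y : M :=
  \sum_(1 <= k < m.+1)
   \sum_(p : {ffun 'I_k -> 'I_m.+1})
    \sum_(q : {ffun 'I_k -> 'I_m.+1} |
          [forall i, (0 < p i + q i)%N] && (\sum_i (p i + q i) == m)%N)
      ((-1) ^+ k.-1 / (k * m * \prod_i ((p i)`! * (q i)`!))%:R) *:
      iterated_bracket
        (flatten [seq nseq (p i) x ++ nseq (q i) y | i <- enum 'I_k]).

Definition bch (nu : nat) x y : M :=
  x + y + \sum_(2 <= m < nu.+1) bch_term m x y.

End Lie.

Section LinearSpan.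
Context {R : realType} {V : lmodType R}.

Definition lin_span (S : set V) : set V :=
  [set v | exists n (c : 'I_n -> R) (w : 'I_n -> V),
     (forall i, S (w i)) /\ v = \sum_i c i *: w i].

End LinearSpan.

(* hg_layer i is the layer H_i for 1 <= i <= hg_step; the other values of
   hg_layer are irrelevant. Continuity of the sum map is automatic. *)
Record banachHomogeneousGroup (R : realType) := BanachHomogeneousGroup {
  hg_lie :> banachLieAlgebra R;
  hg_step : nat;
  hg_layer : nat -> set hg_lie;
  hg_nilpotent : @nilpotent_of_step R hg_lie hg_step;
  hg_layer_subspace : forall i, (1 <= i <= hg_step)%N ->
    submod_closed [in hg_layer i];
  hg_layer_closed : forall i, (1 <= i <= hg_step)%N -> closed (hg_layer i);
  hg_direct_sum :
    set_bij [set h : {ffun 'I_hg_step -> hg_lie} |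
              forall i : 'I_hg_step, hg_layer i.+1 (h i)]
            [set: hg_lie] (fun h => \sum_i h i);
  hg_bracket_layer : forall i j, (1 <= i)%N -> (1 <= j)%N ->
    (i + j <= hg_step)%N -> forall x y, hg_layer i x -> hg_layer j y ->
    hg_layer (i + j)%N [| x, y |];
  hg_bracket_layer0 : forall i j, (1 <= i <= hg_step)%N ->
    (1 <= j <= hg_step)%N -> (hg_step < i + j)%N ->
    forall x y, hg_layer i x -> hg_layer j y -> [| x, y |] = 0 }.

Section Group.
Context {R : realType} {M : banachHomogeneousGroup R}.
Implicit Types (x y : M).

Definition gmul x y : M := bch (hg_step M) x y.

Definition ginv x : M := - x.

(* hg_proj i is the projection onto the layer hg_layer i.+1. *)
Definition hg_proj (i : 'I_(hg_step M)) x : M :=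
  xget (0 : {ffun 'I_(hg_step M) -> M})
    [set h | (forall j : 'I_(hg_step M), hg_layer j.+1 (h j)) /\
             x = \sum_j h j] i.

Definition dilation (r : R) x : M :=
  \sum_(i < hg_step M) r ^+ i.+1 *: hg_proj i x.

Definition hg_norm (sigma : nat -> R) x : R :=
  \big[Num.max/0]_(i < hg_step M)
    (sigma i.+1 * `|hg_proj i x| `^ (i.+1%:R^-1)).

Definition hg_dist (sigma : nat -> R) x y : R :=
  hg_norm sigma (gmul (ginv x) y).

Definition norm_constants (sigma : nat -> R) : Prop :=
  [/\ sigma 1%N = 1,
      forall i, (1 <= i <= hg_step M)%N -> 0 < sigma i &
      forall x y,
        hg_norm sigma (gmul x y) <= hg_norm sigma x + hg_norm sigma y].

End Group.
Arguments norm_constants {R} M sigma.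

Notation "x ** y" := (gmul x y) (at level 40, left associativity) : ring_scope.

Record stratified (R : realType) (G : banachHomogeneousGroup R) : Prop :=
  Stratified {
  stratified_findim : exists n (b : 'I_n -> G), lin_span (range b) = setT;
  stratified_generating : forall j, (1 <= j)%N ->
    lin_span [set [| u, v |] | u in @hg_layer R G 1 & v in @hg_layer R G j]
    = @hg_layer R G j.+1;
  stratified_layer0 : forall j, (hg_step G < j)%N ->
    @hg_layer R G j = [set 0] }.

Record homogeneous_distance (R : realType) (G : banachHomogeneousGroup R)
    (d : G -> G -> R) : Prop := HomogeneousDistance {
  hdist_ge0 : forall x y, 0 <= d x y;
  hdist_eq0 : forall x y, d x y = 0 <-> x = y;
  hdist_sym : forall x y, d x y = d y x;
  hdist_triangle : forall x y z, d x z <= d x y + d y z;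
  hdist_left_invariant : forall x y z, d (z ** x) (z ** y) = d x y;
  hdist_dilation : forall r x y, 0 < r ->
    d (dilation r x) (dilation r y) = r * d x y }.

Notation borel G := (g_sigma_algebraType (@open G)).

(* Left and right Haar measures coincide since G is nilpotent; regularity is
   automatic since G is locally compact and second countable. *)
Record haar_measure (R : realType) (G : banachHomogeneousGroup R)
    (mu : {measure set (borel G) -> \bar R}) : Prop := HaarMeasure {
  haar_left_invariant : forall (x : G) (B : set (borel G)), measurable B ->
    mu (gmul x @` B) = mu B;
  haar_compact : forall K : set G, compact K -> (mu K < +oo)%E;
  haar_neq0 : mu setT != 0%E }.

(* f : G -> M stands for a map defined on A: only its values on A are used. *)
Section Differentiability.
Context {R : realType} {G M : banachHomogeneousGroup R}.
Variables (d : G -> G -> R) (sigma : nat -> R).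
Variables (A : set G) (f : G -> M).

Definition hball (x : G) (r : R) : set G := [set y | d x y < r].

(* mu^* is the outer measure generated by the Borel measure mu; on its
   Caratheodory measurable sets it is the completion of mu. *)
Definition density_point (mu : {measure set (borel G) -> \bar R}) (x : G) :
    Prop :=
  fine ((mu^*)%mu (A `&` hball x r)) / fine ((mu^*)%mu (hball x r))
    @[r --> 0^'+] --> (1 : R).

Definition lipschitz_map : Prop :=
  exists k : R, forall x y, A x -> A y ->
    hg_dist sigma (f x) (f y) <= k * d x y.

Definition approximates (x zeta : G) (z : R -> G) : Prop :=
  (forall t : R, 0 < t -> A (x ** z t)) /\
  (d (z t) (dilation t zeta) / t @[t --> 0^'+] --> (0 : R)).

Definition is_dir_derivative (x zeta : G) (l : M) : Prop :=
  (exists z, approximates x zeta z) /\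
  (forall z, approximates x zeta z ->
    hg_dist sigma (dilation t^-1 (ginv (f x) ** f (x ** z t))) l
      @[t --> 0^'+] --> (0 : R)).

(* The limit is unique, as hg_dist sigma is a distance, so dir_derivative below
   is that limit whenever dir_differentiable holds. *)
Definition dir_differentiable (x zeta : G) : Prop :=
  exists l, is_dir_derivative x zeta l.

Definition dir_derivative (x zeta : G) : M :=
  xget 0 [set l | is_dir_derivative x zeta l].

Definition h_homomorphism (L : G -> M) : Prop :=
  (forall x y, L (x ** y) = L x ** L y) /\
  (forall r x, 0 < r -> L (dilation r x) = dilation r (L x)).

Definition h_differentiable (x : G) : Prop :=
  exists2 L : G -> M, h_homomorphism L &
    forall e : R, 0 < e -> exists2 delta : R, 0 < delta &
      forall z, A (x ** z) -> 0 < d z 0 < delta ->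
        hg_dist sigma (ginv (f x) ** f (x ** z)) (L z) / d z 0 < e.

End Differentiability.

(* Main.v *)
(* With R(x, y) = xy - x - y, the map R is a finite sum of iterated brackets of
   length at least 2, so R(x, y) modulo the layers of index > i + 1 depends only
   on x and y modulo the layers of index > i. Hence p w = z is solved, in w or
   in p, by finitely many iterations of w |-> z - p - R(p, w): left and right
   division exist and are continuous, and this replaces the associativity of
   the group law throughout.
   In G, a function D with D(xy) <= D x + D y and D(delta_r x) = r D x tends to
   0 at 0, by descending induction on the filtration by layers. For D = d(., 0)
   this shows that d induces the norm topology, and for D = ||L(.)|| that every
   h-homomorphism L is continuous.
   If f is h-differentiable at x with differential L, and z_t approximates zeta,
   then delta_{1/t}(f(x)^-1 f(x z_t)) is close to L(delta_{1/t} z_t), which tends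
   to L(zeta); approximating points exist because a d-ball is covered by boundedly
   many balls of a fixed smaller proportion, so A cannot miss the ball of radius
   e t at x delta_t(zeta). Conversely, if h-differentiability fails along points
   z_n, some direction zeta is a cluster point of delta_{1/d(z_n)} z_n, and a
   curve of approximating points in direction zeta through infinitely many z_n
   contradicts the differentiability in direction zeta. *)
Require Import Defs.
From HB Require Import structures.
From mathcomp Require Import all_boot all_order all_algebra.
From mathcomp Require Import all_classical all_reals all_analysis.
Import Order.TTheory GRing.Theory Num.Theory.
Import numFieldNormedType.Exports.
Local Open Scope classical_set_scope.
Local Open Scope ring_scope.

Set Implicit Arguments.
Unset Strict Implicit.
Unset Printing Implicit Defensive.

(** * The Baker-Campbell-Hausdorff product and the layers *)

Section Words.
Context {R : realType} {M : banachLieAlgebra R}.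
Implicit Types (x y : M) (s : seq bool).

Definition word_bracket x y s : M :=
  iterated_bracket [seq if b then x else y | b <- s].

Lemma word_bracket_rcons x y s b : s != [::] ->
  word_bracket x y (rcons s b) =
  [| word_bracket x y s, (if b then x else y) |].
Proof. by case: s => // a s _; rewrite /word_bracket /= map_rcons foldl_rcons. Qed.

(** Dynkin's formula enters later arguments only in this form: finitely many words of length at
    least 2, [true] standing for x and [false] for y, with real coefficients independent of x and
    y. *)
Definition word_sum (F : M -> M -> M) : Prop :=
  exists2 T : seq (R * seq bool), {in T, forall t, (1 < size t.2)%N} &
    forall x y, F x y = \sum_(t <- T) t.1 *: word_bracket x y t.2.

Lemma word_sum_big I (r : seq I) (P : pred I) (F : I -> M -> M -> M) :
  (forall i, P i -> word_sum (F i)) ->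
  word_sum (fun x y => \sum_(i <- r | P i) F i x y).
Proof.
move=> hF; elim: r => [ |i r [T hT eT]].
  by exists [::] => // x y; rewrite !big_nil.
have [Pi|nPi] := boolP (P i); last first.
  by exists T => // x y; rewrite big_cons (negbTE nPi).
have [T' hT' eT'] := hF i Pi; exists (T' ++ T).
  by move=> t; rewrite mem_cat => /orP[/hT'|/hT].
by move=> x y; rewrite big_cons Pi big_cat /= eT eT'.
Qed.

Lemma word_sum_bch_term m : (1 < m)%N -> word_sum (bch_term m).
Proof.
move=> m1; apply: word_sum_big => k _; apply: word_sum_big => p _.
apply: word_sum_big => q /andP[_ /eqP sumpq].
set c := (X in fun x y => X *: _).
set w := flatten [seq nseq (p i) true ++ nseq (q i) false | i <- enum 'I_k].
exists [:: (c, w)].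
  move=> t; rewrite inE => /eqP ->; rewrite /= size_flatten sumnE big_map.
  rewrite big_map big_enum /= (eq_bigr (fun i => (p i + q i)%N)) ?sumpq //.
  by move=> i _; rewrite size_cat !size_nseq.
move=> x y; rewrite big_seq1; congr (_ *: iterated_bracket _).
rewrite map_flatten -map_comp; congr flatten; apply: eq_map => i /=.
by rewrite map_cat !map_nseq.
Qed.

Definition bch_rest nu x y : M := \sum_(2 <= m < nu.+1) bch_term m x y.

Lemma word_sum_bch_rest nu : word_sum (bch_rest nu).
Proof.
have [T hT eT] : word_sum (fun x y =>
    \sum_(2 <= m < nu.+1 | (1 < m)%N) bch_term m x y).
  by apply: word_sum_big => m; apply: word_sum_bch_term.
exists T => // x y; rewrite -eT /bch_rest big_nat_cond [RHS]big_nat_cond.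
by apply: eq_bigl => m; case: (1 < m)%N; rewrite ?andbT ?andbF.
Qed.

Lemma bracket_self x : [| x, x |] = 0.
Proof.
have /eqP := lie_bracket_skew x x.
by rewrite -addr_eq0 -mulr2n -scaler_nat scaler_eq0 pnatr_eq0 => /eqP.
Qed.

(** The innermost bracket is a multiple of [x, x] = 0, and further bracketing keeps it 0. *)
Lemma word_bracket_collinear a b x s : (1 < size s)%N ->
  word_bracket (a *: x) (b *: x) s = 0.
Proof.
elim/last_ind: s => // s e IH; rewrite size_rcons ltnS => s0.
rewrite word_bracket_rcons -?size_eq0 -?lt0n //.
case: s IH s0 => // c [_ _|c' s IH _].
  by case: c e => [] []; rewrite /word_bracket /= linearZl_LR linearZr_LR /=
    bracket_self !scaler0.
by rewrite IH // linear0l.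
Qed.

(** The pairs (a, b) = (1, 0) and (-1, 1) yield the laws x0 = x and (-x)x = 0. *)
Lemma bch_rest_collinear nu a b x : bch_rest nu (a *: x) (b *: x) = 0.
Proof.
have [T hT ->] := word_sum_bch_rest nu.
by rewrite big_seq big1 // => t /hT st; rewrite word_bracket_collinear ?scaler0.
Qed.

End Words.

(** * Layer projections, dilations and the group law *)

Section Layers.
Context {R : realType} {M : banachHomogeneousGroup R}.
Local Notation nu := (hg_step M).
Implicit Types (x y z w : M) (i j k : 'I_nu).

Lemma hg_projP x : (forall j, hg_layer j.+1 (hg_proj j x)) /\
  x = \sum_j hg_proj j x.
Proof.
have [_ _ surj] := hg_direct_sum M.
have [h hl hx] := surj x I.
have := @xgetPex _ (0 : {ffun 'I_nu -> M})
  [set h | (forall j, hg_layer j.+1 (h j)) /\ x = \sum_j h j].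
by apply; exists h.
Qed.

Lemma hg_proj_layer j x : hg_layer j.+1 (hg_proj j x).
Proof. by have [/(_ j)] := hg_projP x. Qed.

Lemma hg_proj_sum x : \sum_j hg_proj j x = x.
Proof. by have [_ <-] := hg_projP x. Qed.

Lemma hg_proj_unique (h : 'I_nu -> M) i :
  (forall j, hg_layer j.+1 (h j)) -> hg_proj i (\sum_j h j) = h i.
Proof.
move=> hl; have [_ inj _] := hg_direct_sum M.
have /(congr1 (fun f : {ffun 'I_nu -> M} => f i)) :
    [ffun j => hg_proj j (\sum_j h j)] = [ffun j => h j].
  apply: inj; rewrite ?inE.
  - by move=> j; rewrite /= ffunE; apply: hg_proj_layer.
  - by move=> j; rewrite /= ffunE.
  - rewrite (eq_bigr (fun j => hg_proj j (\sum_j h j))) ?hg_proj_sum //.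
      by apply: eq_bigr => j _; rewrite ffunE.
    by move=> j _; rewrite ffunE.
by rewrite !ffunE.
Qed.

Lemma hg_layer_lin i a x y :
  hg_layer i.+1 x -> hg_layer i.+1 y -> hg_layer i.+1 (a *: x + y).
Proof.
have [_ h] := @hg_layer_subspace _ M i.+1 (ltn_ord i).
by move=> /mem_set hx /mem_set hy; apply/set_mem; apply: h.
Qed.

Lemma hg_layer0 i : hg_layer i.+1 (0 : M).
Proof.
have [h _] := @hg_layer_subspace _ M i.+1 (ltn_ord i).
exact: set_mem h.
Qed.

Lemma hg_proj_is_linear i : linear (@hg_proj R M i).
Proof.
move=> a x y; rewrite -{1}(hg_proj_sum x) -{1}(hg_proj_sum y).
rewrite scaler_sumr -big_split /= hg_proj_unique // => j.
by apply: hg_layer_lin; apply: hg_proj_layer.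
Qed.

HB.instance Definition _ i :=
  GRing.isLinear.Build R M M *:%R (@hg_proj R M i) (@hg_proj_is_linear i).

Lemma hg_proj_inj x y : (forall i, hg_proj i x = hg_proj i y) -> x = y.
Proof.
by move=> h; rewrite -(hg_proj_sum x) -(hg_proj_sum y); apply: eq_bigr.
Qed.

Lemma hg_proj_of_layer i j x : hg_layer j.+1 x ->
  hg_proj i x = if i == j then x else 0.
Proof.
move=> hx; have {1}-> : x = \sum_k (if k == j then x else 0).
  by rewrite -big_mkcond big_pred1_eq.
rewrite hg_proj_unique // => k; case: eqP => [->//|_]; exact: hg_layer0.
Qed.

(** Index [i] stands for layer [i.+1], so components of indices [i] and [j] have their bracket in
    layer i + j + 2, whose index is [(i + j).+1]; beyond the last layer the bracket vanishes. *)
Lemma hg_proj_bracket k x y :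
  hg_proj k [| x, y |] =
  \sum_(i < nu) \sum_(j < nu) (if (i + j).+1 == k then [| hg_proj i x, hg_proj j y |] else 0).
Proof.
rewrite -{1}(hg_proj_sum x) linear_sumlz linear_sum; apply: eq_bigr => i _.
rewrite -{1}(hg_proj_sum y) linear_sumr linear_sum; apply: eq_bigr => j _ /=.
have [ijn|nij] := ltnP (i + j).+1 nu; last first.
  have ij : (nu < i.+1 + j.+1)%N by rewrite addSn addnS ltnS.
  rewrite (@hg_bracket_layer0 _ M i.+1 j.+1 (ltn_ord i) (ltn_ord j) ij) ?linear0 ?if_same //;
    exact: hg_proj_layer.
rewrite (@hg_proj_of_layer k (Ordinal ijn)) //=.
  by rewrite -val_eqE /= eq_sym.
have := @hg_bracket_layer _ M i.+1 j.+1 isT isT.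
by rewrite addSn addnS; apply; [ |exact: hg_proj_layer..].
Qed.

Lemma hg_proj_dilation i r x : hg_proj i (dilation r x) = r ^+ i.+1 *: hg_proj i x.
Proof.
rewrite /dilation hg_proj_unique // => j.
by rewrite -[_ *: _]addr0; apply: hg_layer_lin; [exact: hg_proj_layer|exact: hg_layer0].
Qed.

Lemma dilation_is_linear r : linear (@dilation R M r).
Proof.
move=> a x y; apply: hg_proj_inj => i.
rewrite hg_proj_dilation linearP [in RHS]linearP /= !hg_proj_dilation.
by rewrite scalerDr !scalerA mulrC.
Qed.

HB.instance Definition _ r :=
  GRing.isLinear.Build R M M *:%R (@dilation R M r) (@dilation_is_linear r).

Lemma dilation1 x : dilation 1 x = x.
Proof. by apply: hg_proj_inj => i; rewrite hg_proj_dilation expr1n scale1r. Qed.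

Lemma dilationM r s x : dilation r (dilation s x) = dilation (r * s) x.
Proof. by apply: hg_proj_inj => i; rewrite !hg_proj_dilation scalerA exprMn. Qed.

Lemma dilationK r x : r != 0 -> dilation r (dilation r^-1 x) = x.
Proof. by move=> r0; rewrite dilationM divff // dilation1. Qed.

Lemma dilationVK r x : r != 0 -> dilation r^-1 (dilation r x) = x.
Proof. by move=> r0; rewrite dilationM mulVf // dilation1. Qed.

Lemma dilation_bracket r x y :
  dilation r [| x, y |] = [| dilation r x, dilation r y |].
Proof.
apply: hg_proj_inj => k; rewrite hg_proj_dilation !hg_proj_bracket.
rewrite scaler_sumr; apply: eq_bigr => i _.
rewrite scaler_sumr; apply: eq_bigr => j _.
rewrite !hg_proj_dilation; case: eqP => [<-|_]; last by rewrite scaler0.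
by rewrite linearZl_LR linearZr_LR /= scalerA -exprD addSn addnS.
Qed.

Lemma dilation_word r x y s :
  dilation r (word_bracket x y s) = word_bracket (dilation r x) (dilation r y) s.
Proof.
elim/last_ind: s => [ |s b IH]; first by rewrite /word_bracket /= linear0.
have [->|s0] := eqVneq s [::]; first by case: b; rewrite /word_bracket.
by rewrite !word_bracket_rcons // dilation_bracket IH; case: b.
Qed.

Definition grest x y : M := bch_rest nu x y.

Lemma gmulE x y : x ** y = x + y + grest x y.
Proof. by []. Qed.

Lemma grest0r x : grest x 0 = 0.
Proof.
by have := bch_rest_collinear nu 1 0 x; rewrite scale1r scale0r.
Qed.

Lemma gmul0 x : x ** 0 = x.
Proof. by rewrite gmulE grest0r !addr0. Qed.

Lemma gmulVg x : ginv x ** x = 0.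
Proof.
rewrite gmulE /ginv addNr add0r.
by have := bch_rest_collinear nu (-1) 1 x; rewrite scale1r scaleN1r.
Qed.

Lemma dilation_gmul r x y :
  dilation r (x ** y) = dilation r x ** dilation r y.
Proof.
have [T hT eT] := @word_sum_bch_rest R M nu.
rewrite !gmulE /grest !eT !linearD linear_sum; congr (_ + _).
by apply: eq_bigr => t _; rewrite linearZ /= dilation_word.
Qed.

Lemma dilation_ginv r x : dilation r (ginv x) = ginv (dilation r x).
Proof. by rewrite /ginv linearN. Qed.

End Layers.

(** * Division and convergence of layer components *)

Section Division.
Context {R : realType} {M : banachHomogeneousGroup R}.
Local Notation nu := (hg_step M).
Implicit Types (x y z p w : M) (i j k : 'I_nu) (n : nat).

(** This is the ideal of sums of layers of index > n; [deep n (x - x')] is congruence modulo that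
    ideal. *)
Definition deep n x : Prop := forall k, (k < n)%N -> hg_proj k x = 0.

Lemma deep_lin n a x y : deep n x -> deep n y -> deep n (a *: x + y).
Proof. by move=> hx hy k kn; rewrite linearP /= hx // hy // scaler0 addr0. Qed.

Lemma deep_zero n : deep n 0.
Proof. by move=> k _; rewrite linear0. Qed.

Lemma deepZ n a x : deep n x -> deep n (a *: x).
Proof. by move=> hx; rewrite -[_ *: _]addr0; apply: deep_lin => //; apply: deep_zero. Qed.

Lemma deepD n x y : deep n x -> deep n y -> deep n (x + y).
Proof. by rewrite -{2}(scale1r x); apply: deep_lin. Qed.

Lemma deepN n x : deep n x -> deep n (- x).
Proof. by rewrite -scaleN1r; apply: deepZ. Qed.

Lemma deepB n x y : deep n x -> deep n y -> deep n (x - y).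
Proof. by move=> hx hy; apply: deepD => //; apply: deepN. Qed.

Lemma deep_sum n I (r : seq I) (P : pred I) (F : I -> M) :
  (forall e, P e -> deep n (F e)) -> deep n (\sum_(e <- r | P e) F e).
Proof. by move=> hF; apply: big_ind => //; [exact: deep_zero|exact: deepD]. Qed.

Lemma deep_le m n x : (m <= n)%N -> deep n x -> deep m x.
Proof. by move=> mn hx k km; apply: hx; apply: leq_trans mn. Qed.

Lemma deep_eq0 x : deep nu x -> x = 0.
Proof. by move=> hx; apply: hg_proj_inj => i; rewrite hx // linear0. Qed.

Lemma deep_bracketl n x y : deep n x -> deep n.+1 [| x, y |].
Proof.
move=> hx k kn; rewrite hg_proj_bracket big1 // => i _; rewrite big1 // => j _.
case: eqP => // ijk; rewrite hx ?linear0l //.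
by rewrite -ijk ltnS in kn; apply: leq_ltn_trans kn; apply: leq_addr.
Qed.

Lemma deep_bracketr n x y : deep n y -> deep n.+1 [| x, y |].
Proof. by move=> hy; rewrite lie_bracket_skew; apply/deepN/deep_bracketl. Qed.

(** Telescoping: [u, a] - [u', a'] = [u - u', a] + [u', a - a'], and a bracket raises depth by one.
    The boolean counts as the level gained by words of length at least 2. *)
Lemma word_bracket_deep n x x' y y' s : deep n (x - x') -> deep n (y - y') ->
  deep (n + (1 < size s)) (word_bracket x y s - word_bracket x' y' s).
Proof.
move=> hx hy; elim/last_ind: s => [ |s b IH].
  by rewrite /word_bracket /= subrr; apply: deep_zero.
have [->|s0] := eqVneq s [::]; first by rewrite addn0; case: b.
rewrite size_rcons ltnS lt0n size_eq0 s0 addn1 !word_bracket_rcons //.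
set u := word_bracket x y s; set u' := word_bracket x' y' s.
set a := if b then x else y; set a' := if b then x' else y'.
have -> : [| u, a |] - [| u', a' |] = [| u - u', a |] + [| u', a - a' |].
  by rewrite linearBl linearB /= addrA subrK.
apply: deepD; first by apply: deep_bracketl; apply: deep_le IH; apply: leq_addr.
by apply: deep_bracketr; rewrite /a /a'; case: (b).
Qed.

(** All words in [grest] have length at least 2, so [grest] strictly contracts the filtration by
    depth. *)
Lemma grest_deep n x x' y y' : deep n (x - x') -> deep n (y - y') ->
  deep n.+1 (grest x y - grest x' y').
Proof.
move=> hx hy; have [T hT eT] := @word_sum_bch_rest R M nu.
rewrite /grest !eT -sumrB big_seq; apply: deep_sum => t /hT st.
rewrite -scalerBr; apply: deepZ.
by have := word_bracket_deep (s := t.2) hx hy; rewrite st addn1.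
Qed.

Section Contraction.
Variable F : M -> M.
Hypothesis hF : forall n w w', deep n (w - w') -> deep n.+1 (F w - F w').

(** A discrete Banach fixed point argument: the n-th iterate is a fixed point up to an error of
    depth n, and an error of depth [nu] is 0. *)
Lemma contraction_fixpoint : F (iter nu F 0) = iter nu F 0.
Proof.
apply/eqP; rewrite -subr_eq0; apply/eqP/deep_eq0.
have h n : deep n (F (iter n F 0) - iter n F 0); last exact: h.
by elim: n => [//|n IH]; rewrite !iterS; apply: hF.
Qed.

Lemma contraction_unique w w' : F w = w -> F w' = w' -> w = w'.
Proof.
move=> hw hw'; apply/eqP; rewrite -subr_eq0; apply/eqP/deep_eq0.
have h n : deep n (w - w'); last exact: h.
by elim: n => [//|n IH]; rewrite -hw -hw'; apply: hF.
Qed.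

End Contraction.

(** The equation [p ** w = z] reads w = z - p - R(p, w) or p = z - w - R(p, w), fixed point
    equations for contractions in w and in p; [nu] iterations from 0 solve them. *)
Definition ldiv p z : M := iter nu (fun w => z - p - grest p w) 0.
Definition rdiv z w : M := iter nu (fun p => z - w - grest p w) 0.

Let ldiv_contract p z n w w' : deep n (w - w') ->
  deep n.+1 ((z - p - grest p w) - (z - p - grest p w')).
Proof.
move=> hw; rewrite opprB addrC addrA subrK -opprB.
by apply/deepN/grest_deep => //; rewrite subrr; apply: deep_zero.
Qed.

Let rdiv_contract z w n p p' : deep n (p - p') ->
  deep n.+1 ((z - w - grest p w) - (z - w - grest p' w)).
Proof.
move=> hw; rewrite opprB addrC addrA subrK -opprB.
by apply/deepN/grest_deep => //; rewrite subrr; apply: deep_zero.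
Qed.

Lemma ldivK p z : p ** ldiv p z = z.
Proof.
have e := contraction_fixpoint (ldiv_contract p z).
by rewrite gmulE /ldiv -{1}e [p + _]addrC [_ - _ - _]addrAC !subrK.
Qed.

Lemma rdivK z w : rdiv z w ** w = z.
Proof.
have e := contraction_fixpoint (rdiv_contract z w).
by rewrite gmulE /rdiv -{1}e [_ - _ - _]addrAC !subrK.
Qed.

(** Both factors are fixed points of the division contraction for the common product. *)
Lemma gmul_injl p w w' : p ** w = p ** w' -> w = w'.
Proof.
rewrite !gmulE => e; pose z := p + w + grest p w.
apply: (contraction_unique (@ldiv_contract p z)); rewrite /z.
  by rewrite addrAC addrK addrC addKr.
by rewrite e addrAC addrK addrC addKr.
Qed.

Lemma gmul_injr w p p' : p ** w = p' ** w -> p = p'.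
Proof.
rewrite !gmulE => e; pose z := p + w + grest p w.
apply: (contraction_unique (@rdiv_contract z w)); rewrite /z.
  by rewrite addrAC !addrK.
by rewrite e addrAC !addrK.
Qed.

Lemma ldivxx p : ldiv p p = 0.
Proof. by apply: (@gmul_injl p); rewrite ldivK gmul0. Qed.

Lemma rdiv0 w : rdiv 0 w = ginv w.
Proof. by apply: (@gmul_injr w); rewrite rdivK gmulVg. Qed.

(** Bootstrap: if the quotient w has depth m, then R(p, w) = R(p, w) - R(p, 0) has depth m + 1, and
    so has w = z - p - R(p, w) as long as m < n. *)
Lemma ldiv_deep n p z : deep n (z - p) -> deep n (ldiv p z).
Proof.
move=> hzp; suff h m : (m <= n)%N -> deep m (ldiv p z) by apply: h.
elim: m => [//|m IH mn].
rewrite /ldiv -(contraction_fixpoint (@ldiv_contract p z)) -/(ldiv p z).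
apply: deepB; first exact: deep_le hzp.
rewrite -[grest _ _]subr0 -(grest0r p); apply: grest_deep.
  by rewrite subrr; apply: deep_zero.
by rewrite subr0; apply: IH; apply: ltnW.
Qed.

(** The difference is -(R(u, v) - R(0, 0)). It makes sum and product agree up to a factor one level
    deeper, which drives the induction on layers for gauges. *)
Lemma gmul_deep n u v : deep n u -> deep n v -> deep n.+1 (u + v - u ** v).
Proof.
move=> hu hv; rewrite gmulE opprD addrA subrr add0r; apply: deepN.
by rewrite -[grest _ _]subr0 -(grest0r 0); apply: grest_deep; rewrite subr0.
Qed.

End Division.

Lemma cvg_sum (R : realType) (V : normedModType R) (T : Type)
    (F : set_system T) {FF : Filter F} (I : Type) (r : seq I) (P : pred I)
    (f : I -> T -> V) (l : I -> V) :
  (forall i, P i -> f i t @[t --> F] --> l i) ->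
  \sum_(i <- r | P i) f i t @[t --> F] --> \sum_(i <- r | P i) l i.
Proof. by apply: cvg_big => //; exact: add_continuous. Qed.

Section GradedConvergence.
Context {R : realType} {M : banachHomogeneousGroup R}.
Local Notation nu := (hg_step M).
Context {T : Type} {F : set_system T} {FF : Filter F}.
Implicit Types (g h : T -> M) (l : M).

(* Equivalent to convergence in norm by the open mapping theorem, which this
   definition makes unnecessary. *)
Definition gcvg g l : Prop :=
  forall i : 'I_nu, hg_proj i (g t) @[t --> F] --> hg_proj i l.

Lemma gcvg_norm g l : gcvg g l -> g t @[t --> F] --> l.
Proof.
move=> hg; rewrite -(hg_proj_sum l).
rewrite (_ : (fun t => g t) = fun t => \sum_i hg_proj i (g t)).
  by apply: cvg_sum => i _; apply: hg.
by apply/funext => t; rewrite hg_proj_sum.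
Qed.

Lemma gcvg_cst l : gcvg (fun=> l) l.
Proof. by move=> i; apply: cvg_cst. Qed.

Lemma gcvgD g h l l' : gcvg g l -> gcvg h l' -> gcvg (fun t => g t + h t) (l + l').
Proof.
move=> hg hh i; rewrite linearD; under eq_fun do rewrite linearD.
exact: cvgD (hg i) (hh i).
Qed.

Lemma gcvgZ a g l : gcvg g l -> gcvg (fun t => a *: g t) (a *: l).
Proof.
move=> hg i; rewrite linearZ; under eq_fun do rewrite linearZ.
exact: cvgZl_tmp (hg i).
Qed.

Lemma gcvgN g l : gcvg g l -> gcvg (fun t => - g t) (- l).
Proof.
move=> /(gcvgZ (a := -1)); rewrite scaleN1r; congr gcvg; apply/funext => t.
by rewrite scaleN1r.
Qed.

Lemma gcvgB g h l l' : gcvg g l -> gcvg h l' -> gcvg (fun t => g t - h t) (l - l').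
Proof. by move=> hg hh; apply: gcvgD => //; apply: gcvgN. Qed.

Lemma gcvg_sum I (r : seq I) (P : pred I) (g : I -> T -> M) (l : I -> M) :
  (forall i, P i -> gcvg (g i) (l i)) ->
  gcvg (fun t => \sum_(i <- r | P i) g i t) (\sum_(i <- r | P i) l i).
Proof.
move=> hg i; rewrite linear_sum; under eq_fun do rewrite linear_sum.
by apply: cvg_sum => j Pj; apply: hg.
Qed.

Lemma gcvg_bracket g h l l' : gcvg g l -> gcvg h l' ->
  gcvg (fun t => [| g t, h t |]) [| l, l' |].
Proof.
move=> hg hh k; rewrite hg_proj_bracket; under eq_fun do rewrite hg_proj_bracket.
apply: cvg_sum => i _; apply: cvg_sum => j _; case: eqP => _; last exact: cvg_cst.
apply: (@continuous2_cvg _ _ _ _ F FF (fun t => hg_proj i (g t))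
  (fun t => hg_proj j (h t)) (fun x y : M => [| x, y |])) => //.
exact: (@lie_bracket_continuous R M (hg_proj i l, hg_proj j l')).
Qed.

Lemma gcvg_word g h l l' s : gcvg g l -> gcvg h l' ->
  gcvg (fun t => word_bracket (g t) (h t) s) (word_bracket l l' s).
Proof.
move=> hg hh; elim/last_ind: s => [ |s b IH]; first exact: gcvg_cst.
have [->|s0] := eqVneq s [::]; first by case: b.
rewrite word_bracket_rcons //; under eq_fun do rewrite word_bracket_rcons //.
by apply: gcvg_bracket => //; case: b.
Qed.

Lemma gcvg_grest g h l l' : gcvg g l -> gcvg h l' ->
  gcvg (fun t => grest (g t) (h t)) (grest l l').
Proof.
move=> hg hh; have [w _ ew] := @word_sum_bch_rest R M nu.
rewrite /grest ew; under eq_fun do rewrite ew.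
by apply: gcvg_sum => t _; apply: gcvgZ; apply: gcvg_word.
Qed.

Lemma gcvg_gmul g h l l' : gcvg g l -> gcvg h l' ->
  gcvg (fun t => g t ** h t) (l ** l').
Proof.
move=> hg hh; rewrite gmulE; under eq_fun do rewrite gmulE.
by apply: gcvgD; [apply: gcvgD|apply: gcvg_grest].
Qed.

Lemma gcvg_ginv g l : gcvg g l -> gcvg (fun t => ginv (g t)) (ginv l).
Proof. exact: gcvgN. Qed.

(** Division is a fixed number of iterations of continuous operations. *)
Lemma gcvg_ldiv g h l l' : gcvg g l -> gcvg h l' ->
  gcvg (fun t => ldiv (g t) (h t)) (ldiv l l').
Proof.
move=> hg hh; rewrite /ldiv; elim: (X in iter X) => [ |n IH].
  exact: gcvg_cst.
by rewrite iterS; under eq_fun do rewrite iterS;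
   apply: gcvgB; [apply: gcvgB|apply: gcvg_grest].
Qed.

Lemma gcvg_rdiv g h l l' : gcvg g l -> gcvg h l' ->
  gcvg (fun t => rdiv (g t) (h t)) (rdiv l l').
Proof.
move=> hg hh; rewrite /rdiv; elim: (X in iter X) => [ |n IH].
  exact: gcvg_cst.
by rewrite iterS; under eq_fun do rewrite iterS;
   apply: gcvgB; [apply: gcvgB|apply: gcvg_grest].
Qed.

Lemma gcvg_unique {PF : ProperFilter F} g l l' : gcvg g l -> gcvg g l' -> l = l'.
Proof.
by move=> hl hl'; apply: hg_proj_inj => i; apply: cvg_unique (hl i) (hl' i).
Qed.

End GradedConvergence.
Arguments gcvg {R M T} F g l.

(** * Homogeneous norms and finite dimensional spaces *)

Lemma root_lt (R : realType) (c e y : R) n : 0 < c -> 0 < e -> 0 <= y ->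
  (c * y `^ (n.+1%:R^-1) < e) = (y < (e / c) ^+ n.+1).
Proof.
move=> c0 e0 y0; rewrite mulrC -ltr_pdivlMr //.
rewrite -(@ltr_pXn2r _ n.+1) ?nnegrE ?powR_ge0 ?divr_ge0 ?(ltW e0) ?(ltW c0) //.
by rewrite -(@powR_mulrn _ (y `^ _)) ?powR_ge0 // -powRrM mulVf ?pnatr_eq0 // powRr1.
Qed.

Lemma eq_nonneg_lt (R : realType) (a b : R) : 0 <= a -> 0 <= b ->
  (forall e, 0 < e -> (a < e) = (b < e)) -> a = b.
Proof.
move=> a0 b0 h; apply/eqP; rewrite eq_le.
apply/andP; split; rewrite leNgt; apply/negP => ab.
  by have := h _ (le_lt_trans b0 ab); rewrite ltxx ab.
by have := h _ (le_lt_trans a0 ab); rewrite ltxx ab.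
Qed.

Section HomogeneousNorm.
Context {R : realType} {M : banachHomogeneousGroup R}.
Local Notation nu := (hg_step M).
Variable sigma : nat -> R.
Hypothesis sigma_gt0 : forall i : 'I_nu, 0 < sigma i.+1.
Implicit Types (x y : M) (i : 'I_nu).
Local Notation N := (@hg_norm R M sigma).
Local Notation rho := (@hg_dist R M sigma).

Lemma hg_norm_ge0 x : 0 <= N x.
Proof. exact: bigmax_ge_id. Qed.

(** Sublevel sets of the norm are products of balls in the layers; this form is free of roots and
    maxima. *)
Lemma hg_norm_ltP x e : 0 < e ->
  N x < e <-> forall i, `|hg_proj i x| < (e / sigma i.+1) ^+ i.+1.
Proof.
move=> e0; split => [/bigmax_ltP[_ h] i|h]; first by rewrite -root_lt ?h.
by apply/bigmax_ltP; split => // i _; rewrite root_lt.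
Qed.

Lemma hg_norm_dilation r x : 0 < r -> N (dilation r x) = r * N x.
Proof.
move=> r0; apply: eq_nonneg_lt.
- exact: hg_norm_ge0.
- by rewrite mulr_ge0 ?hg_norm_ge0 ?ltW.
move=> e e0; rewrite mulrC -ltr_pdivlMr //.
apply/idP/idP => /hg_norm_ltP h; apply/hg_norm_ltP; rewrite ?divr_gt0 // => i.
  have := h e0 i; rewrite hg_proj_dilation normrZ normrX (gtr0_norm r0).
  by rewrite mulrC -ltr_pdivlMr ?exprn_gt0 // -expr_div_n mulrAC.
rewrite hg_proj_dilation normrZ normrX (gtr0_norm r0).
rewrite mulrC -ltr_pdivlMr ?exprn_gt0 // -expr_div_n mulrAC.
by apply: h; rewrite divr_gt0.
Qed.

Lemma hg_distE x y : rho x y = N (ginv x ** y).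
Proof. by []. Qed.

Lemma hg_dist_ge0 x y : 0 <= rho x y.
Proof. exact: hg_norm_ge0. Qed.

Lemma hg_dist_dilation r x y : 0 < r ->
  rho (dilation r x) (dilation r y) = r * rho x y.
Proof.
by move=> r0; rewrite !hg_distE -dilation_ginv -dilation_gmul hg_norm_dilation.
Qed.

Section Limits.
Context {T : Type} {F : set_system T} {FF : Filter F}.
Implicit Types (g h : T -> M) (l : M).

Lemma gcvg0_norm g : gcvg F g 0 <-> N (g t) @[t --> F] --> (0 : R).
Proof.
split=> [hg|/cvgr0Pnorm_lt hg].
  apply/cvgr0Pnorm_lt => e e0.
  have hi i : hg_proj i (g t) @[t --> F] --> (0 : M) by have := hg i; rewrite linear0.
  have hlt i : \forall t \near F, `|hg_proj i (g t)| < (e / sigma i.+1) ^+ i.+1.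
    by move/cvgr0Pnorm_lt: (hi i); apply; rewrite exprn_gt0 // divr_gt0.
  have := filter_forall FF hlt.
  by apply: filterS => t ht; rewrite ger0_norm ?hg_norm_ge0 //; apply/hg_norm_ltP.
move=> i; rewrite linear0; apply/cvgr0Pnorm_lt => e e0.
(* With m = min(1, e) one has m^(i+1) <= m <= e; the factor [sigma i.+1] below cancels the division
   in [hg_norm_ltP]. *)
have m0 : 0 < Num.min 1 e by rewrite lt_min ltr01.
have d0 : 0 < sigma i.+1 * Num.min 1 e by rewrite mulr_gt0.
have := hg _ d0; apply: filterS => t.
rewrite ger0_norm ?hg_norm_ge0 // => /(hg_norm_ltP _ d0)/(_ i) /lt_le_trans.
apply; rewrite mulrAC divff ?gt_eqF // mul1r.
apply: (@le_trans _ _ (Num.min 1 e)); last by rewrite ge_min lexx orbT.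
by rewrite exprS ler_piMr ?(ltW m0) // exprn_ile1 ?(ltW m0) // ge_min lexx.
Qed.

Lemma hg_dist_cvg g h l : gcvg F g l -> gcvg F h l ->
  rho (g t) (h t) @[t --> F] --> (0 : R).
Proof.
move=> hg hh; apply/gcvg0_norm; rewrite -(gmulVg l).
by apply: gcvg_gmul => //; apply: gcvg_ginv.
Qed.

(** Right division by [h t] recovers [ginv (g t)] from [ginv (g t) ** h t], which tends to 0; hence
    [ginv (g t)] tends to [rdiv 0 l = ginv l]. *)
Lemma cvg_hg_dist g h l : rho (g t) (h t) @[t --> F] --> (0 : R) ->
  gcvg F h l -> gcvg F g l.
Proof.
move=> /gcvg0_norm hgh hh.
have := gcvg_ginv (gcvg_rdiv hgh hh); rewrite rdiv0 [ginv (ginv l)]opprK => hl.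
have -> : g = fun t => ginv (rdiv (ginv (g t) ** h t) (h t)); last exact: hl.
apply/funext => t; rewrite -[LHS]opprK; congr (- _).
by apply: (@gmul_injr _ _ (h t)); rewrite rdivK.
Qed.

End Limits.
End HomogeneousNorm.

(** * Finite dimensional normed spaces *)

Section FiniteDimension.
Context {R : realType} {V : normedModType R}.
Hypothesis fd : exists n (b : 'I_n -> V), lin_span (range b) = setT.

Let spanning n (b : 'I_n -> V) :=
  forall z, exists c : 'rV[R]_n, z = \sum_k c 0 k *: b k.

Lemma findim_spanning : exists n (b : 'I_n -> V), spanning b.
Proof.
have [n [b hb]] := fd; exists n, b => z.
have : lin_span (range b) z by rewrite hb.
move=> [m [c [w [hw ->]]]].
apply: (big_ind (fun z => exists c : 'rV[R]_n, z = \sum_k c 0 k *: b k)).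
- by exists 0; rewrite big1 // => k _; rewrite mxE scale0r.
- move=> _ _ [c1 ->] [c2 ->]; exists (c1 + c2).
  by rewrite -big_split; apply: eq_bigr => k _; rewrite mxE scalerDl.
- move=> i _; have [k _ <-] := hw i; exists (c i *: delta_mx 0 k).
  rewrite (bigD1 k) //= big1 ?addr0 => [ |j jk].
    by rewrite !mxE !eqxx mulr1.
  by rewrite !mxE eqxx (negbTE jk) mulr0 scale0r.
Qed.

(** A spanning family of least size is free: a relation with [c 0 k != 0] would express [b k]
    through the others and allow its removal. *)
Lemma findim_free : exists n (b : 'I_n -> V), spanning b /\
  forall c : 'rV[R]_n, \sum_k c 0 k *: b k = 0 -> c = 0.
Proof.
pose P n := `[< exists b : 'I_n -> V, spanning b >].
have exP : exists n, P n.
  by have [n [b hb]] := findim_spanning; exists n; apply/asboolP; exists b.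
case: (ex_minnP exP) => n /asboolP[b hb] nmin; exists n, b; split => // c hc.
apply/eqP; apply: contraT => /matrix0Pn[i [k]]; rewrite ord1 {i} => ck.
suff : P n.-1 by move=> /nmin; rewrite leqNgt ltn_predL (leq_ltn_trans (leq0n k) (ltn_ord k)).
apply/asboolP; exists (fun j => b (lift k j)) => z; have [a ->] := hb z.
exists (\row_j (a 0 (lift k j) - a 0 k / c 0 k * c 0 (lift k j))).
rewrite (bigD1_ord k) //=; move: hc; rewrite (bigD1_ord k) //= => hc.
under [RHS]eq_bigr do rewrite mxE scalerBl -scalerA.
rewrite sumrB -scaler_sumr.
have -> : \sum_(j < n.-1) c 0 (lift k j) *: b (lift k j) = - (c 0 k *: b k).
  by apply/eqP; rewrite -addr_eq0 addrC hc.
by rewrite scalerN opprK scalerA divfK // addrC.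
Qed.

Lemma lincomb_continuous n (b : 'I_n -> V) :
  continuous (fun c : 'rV[R]_n => \sum_k c 0 k *: b k).
Proof.
move=> c; apply: (@cvg_sum _ _ _ (nbhs c)) => k _.
by apply: cvgZr_tmp; apply: coord_continuous.
Qed.

(** Equivalence of norms: the image of the unit sphere of coordinates is compact and misses 0, hence
    misses a ball of some radius m at 0; by scaling, C = 1/m works. *)
Lemma findim_basis : exists n (b : 'I_n -> V) (coord : V -> 'rV[R]_n) (C : R),
  [/\ 0 < C, forall z, z = \sum_k coord z 0 k *: b k &
     forall z, `|coord z| <= C * `|z| ].
Proof.
have [n [b [hb free]]] := findim_free.
have [coord hc] := choice hb; exists n, b, coord.
pose phi (c : 'rV[R]_n) := \sum_k c 0 k *: b k.
have phic : continuous phi by apply: lincomb_continuous.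
pose S := [set c : 'rV[R]_n | `|c| = 1].
have cS : compact S.
  apply: bounded_closed_compact.
    by exists 1; split => // x x1 c; rewrite /S /= => ->; apply: ltW.
  by apply: (closed_comp (f := fun c : 'rV[R]_n => `|c|) (D := [set 1]));
    [move=> c _; apply: norm_continuous|exact: closed_eq].
have clS : closed (phi @` S).
  apply: compact_closed; first exact: norm_hausdorff.
  by apply: continuous_compact => //; apply: continuous_subspaceT.
have : (~` (phi @` S)) 0.
  move=> [c c1 /free c0]; move: c1; rewrite /S /= c0 normr0 => /eqP.
  by rewrite eq_sym oner_eq0.
have /open_nbhs_nbhs : open_nbhs 0 (~` (phi @` S)).
  split; first by rewrite openC.
  move=> [c c1 /free c0]; move: c1; rewrite /S /= c0 normr0 => /eqP.
  by rewrite eq_sym oner_eq0.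
move=> /nbhs_norm0P[m /= m0 hm] _; exists m^-1; split; rewrite ?invr_gt0 // => z.
have [->|z0] := eqVneq (coord z) 0.
  by rewrite normr0 mulr_ge0 ?normr_ge0 // invr_ge0 ltW.
rewrite ler_pdivlMl // mulrC; set r := `|coord z|.
have r0 : 0 < r by rewrite normr_gt0.
have : ~ `|phi (r^-1 *: coord z)| < m.
  move=> /hm; apply; exists (r^-1 *: coord z) => //.
  by rewrite /S /= normrZ ger0_norm ?invr_ge0 ?(ltW r0) // mulVf ?gt_eqF.
move=> /negP; rewrite -leNgt.
have -> : phi (r^-1 *: coord z) = r^-1 *: z.
  rewrite {2}(hc z) /phi scaler_sumr; apply: eq_bigr => k _.
  by rewrite mxE scalerA.
by rewrite normrZ ger0_norm ?invr_ge0 ?(ltW r0) // ler_pdivlMl.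
Qed.

Lemma findim_linear_continuous (W : normedModType R) (f : {linear V -> W}) :
  continuous f.
Proof.
have [n [b [coord [C [C0 hz hC]]]]] := findim_basis.
apply/bounded_linear_continuous/linear_boundedP.
exists (\sum_k C * `|f (b k)|); split; first exact: num_real.
move=> r hr x; apply: (@le_trans _ _ ((\sum_k C * `|f (b k)|) * `|x|)); last first.
  by rewrite ler_wpM2r // ltW.
rewrite {1}(hz x) linear_sum mulr_suml; apply: le_trans (ler_norm_sum _ _ _) _.
apply: ler_sum => k _; rewrite linearZ normrZ mulrAC ler_wpM2r //.
apply: le_trans (hC x); rewrite [leRHS]/Num.Def.normr /= mx_normrE.
exact: (le_bigmax _ (fun ij : 'I_1 * 'I_n => `|coord x ij.1 ij.2|) (0, k)).
Qed.

(** The ball is a closed subset of the continuous image of a compact ball of coordinates. *)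
Lemma findim_bounded_compact (B : R) : compact [set z : V | `|z| <= B].
Proof.
have [n [b [coord [C [C0 hz hC]]]]] := findim_basis.
pose phi (c : 'rV[R]_n) := \sum_k c 0 k *: b k.
have phic : continuous phi by apply: lincomb_continuous.
have cB : compact [set c : 'rV[R]_n | `|c| <= C * B].
  apply: bounded_closed_compact.
    exists (C * B); split; first exact: num_real.
    by move=> x x1 c /= /le_trans; apply; apply: ltW.
  by apply: (closed_comp (f := fun c : 'rV[R]_n => `|c|) (D := [set x | x <= C * B]));
    [move=> c _; apply: norm_continuous|exact: closed_le].
apply: (@subclosed_compact _ _ (phi @` [set c : 'rV[R]_n | `|c| <= C * B])).
- by apply: (closed_comp (f := fun c : V => `|c|) (D := [set x | x <= B]));
    [move=> c _; apply: norm_continuous|exact: closed_le].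
- by apply: continuous_compact => //; apply: continuous_subspaceT.
- move=> z /= zB; exists (coord z); last by rewrite /phi -hz.
  by rewrite /= (le_trans (hC z)) // ler_wpM2l // ltW.
Qed.

End FiniteDimension.

(** * Comparison of a homogeneous distance with the norm *)

Section FiniteDimensionalGroup.
Context {R : realType} {G : banachHomogeneousGroup R}.
Hypothesis fd : exists n (b : 'I_n -> G), lin_span (range b) = setT.
Local Notation nu := (hg_step G).

Lemma hg_proj_continuous (i : 'I_nu) : continuous (@hg_proj R G i).
Proof. exact: (findim_linear_continuous fd). Qed.

Lemma norm_gcvg (T : Type) (F : set_system T) {FF : Filter F} (g : T -> G) l :
  g t @[t --> F] --> l -> gcvg F g l.
Proof. by move=> hg i; apply: cvg_comp hg (@hg_proj_continuous i l). Qed.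

Lemma dilation_layer (i : 'I_nu) r (e : G) : hg_layer i.+1 e ->
  dilation r e = r ^+ i.+1 *: e.
Proof.
move=> he; apply: hg_proj_inj => j; rewrite hg_proj_dilation linearZ /=.
by rewrite (hg_proj_of_layer j he); case: eqP => [->| ]; rewrite ?scaler0.
Qed.

(** * Subadditive homogeneous functions tend to 0 at 0 *)

Section Gauge.
Variable D : G -> R.
Hypothesis D_ge0 : forall x, 0 <= D x.
Hypothesis D_mul : forall x y, D (x ** y) <= D x + D y.
Hypothesis D_dilation : forall r x, 0 < r -> D (dilation r x) = r * D x.

Lemma gauge0 : D 0 = 0.
Proof.
have := D_dilation 0 (ltr0n R 2); rewrite linear0 => /eqP.
by rewrite mulr2n mulrDl mul1r eq_sym -subr_eq0 addrK => /eqP.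
Qed.

Section Limits.
Context {T : Type} {F : set_system T} {FF : Filter F}.

(** Along one line of layer i + 1, c e is the dilate of e or -e by s = |c|^(1/(i+1)), so its gauge
    is s times a constant. *)
Lemma gauge_layer_cvg0 (i : 'I_nu) (e : G) (c : T -> R) : hg_layer i.+1 e ->
  c t @[t --> F] --> (0 : R) -> D (c t *: e) @[t --> F] --> (0 : R).
Proof.
move=> he /cvgr0Pnorm_lt hc; apply/cvgr0Pnorm_lt => eps eps0.
(* K bounds the gauge of e and of -e, whatever the sign of [c t]; the summand 1 makes it
   positive. *)
pose K := D e + D (- e) + 1.
have K0 : 0 < K by rewrite ltr_wpDl // addr_ge0.
have := hc _ (exprn_gt0 i.+1 (divr_gt0 eps0 K0)); apply: filterS => t.
rewrite -root_lt // (ger0_norm (D_ge0 _)); set s := _ `^ _ => hs.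
have [->|ct0] := eqVneq (c t) 0; first by rewrite scale0r gauge0.
have s0 : 0 < s by rewrite powR_gt0 // normr_gt0.
have es : s ^+ i.+1 = `|c t|.
  by rewrite -powR_mulrn ?(ltW s0) // -powRrM mulVf ?pnatr_eq0 // powRr1.
apply: le_lt_trans hs.
have -> : c t *: e = dilation s (Num.sg (c t) *: e).
  by rewrite linearZ /= (dilation_layer _ he) scalerA es -numEsg.
rewrite D_dilation // mulrC ler_wpM2r ?(ltW s0) // /K.
case: sgrP ct0 => // _ _; rewrite ?scale1r ?scaleN1r -addrA.
  by rewrite lerDl addr_ge0.
by rewrite addrCA lerDl addr_ge0.
Qed.

Variable j : nat.
Let small (u : T -> G) := [/\ forall t, deep j (u t), gcvg F u 0 &
  D (u t) @[t --> F] --> (0 : R)].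
Hypothesis deeper : forall u : T -> G, (forall t, deep j.+1 (u t)) ->
  u t @[t --> F] --> (0 : G) -> D (u t) @[t --> F] --> (0 : R).

(* u + v = (u ** v) ** q with q one level deeper than u and v. *)
Let small_add u v : small u -> small v -> small (fun t => u t + v t).
Proof.
move=> [du cu Du] [dv cv Dv].
have cuv : gcvg F (fun t => u t + v t) 0.
  by rewrite -[X in gcvg _ _ X](addr0 (0 : G)); apply: gcvgD.
split=> [t|//| ]; first exact: deepD.
pose q t := ldiv (u t ** v t) (u t + v t).
have cq : gcvg F q 0.
  have : gcvg F q (ldiv (0 ** 0) 0) by apply: gcvg_ldiv => //; apply: gcvg_gmul.
  by rewrite gmul0 ldivxx.
have Dq : D (q t) @[t --> F] --> (0 : R).
  by apply: deeper; [move=> t; apply/ldiv_deep/gmul_deep|apply: gcvg_norm].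
have le t : 0 <= D (u t + v t) <= D (u t) + D (v t) + D (q t).
  rewrite D_ge0 -{1}(ldivK (u t ** v t) (u t + v t)) (le_trans (D_mul _ _)) //.
  by rewrite lerD2r D_mul.
apply: (squeeze_cvgr (nearW _ le)); first exact: cvg_cst.
rewrite -[X in _ --> X](addr0 (0 : R)) -[X in _ --> X + _](addr0 (0 : R)).
by apply: cvgD => //; apply: cvgD.
Qed.

Let small_sum I (r : seq I) (P : pred I) (f : I -> T -> G) :
  (forall i, P i -> small (f i)) -> small (fun t => \sum_(i <- r | P i) f i t).
Proof.
move=> hf; elim: r => [ |i r IH].
  under eq_fun do rewrite big_nil.
  split=> [t| | ]; [exact: deep_zero|exact: gcvg_cst| ].
  by rewrite gauge0; apply: cvg_cst.
have [Pi|nPi] := boolP (P i); last first.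
  by under eq_fun do rewrite big_cons (negbTE nPi).
have := small_add (hf i Pi) IH; congr small; apply/funext => t.
by rewrite big_cons Pi.
Qed.

(** [deeper] is the induction hypothesis. In a basis, g is a finite sum of scalar functions tending
    to 0 times fixed vectors of single layers; each summand is a one-layer case, and [small_add]
    assembles them. *)
Lemma gauge_step (g : T -> G) : (forall t, deep j (g t)) ->
  g t @[t --> F] --> (0 : G) -> D (g t) @[t --> F] --> (0 : R).
Proof.
move=> dg cg; have [n [b [coord [C [C0 hz hC]]]]] := findim_basis fd.
have cc k : coord (g t) 0 k @[t --> F] --> (0 : R).
  apply/cvgr0Pnorm_lt => e e0; have /cvgr0Pnorm_lt := cg.
  move=> /(_ _ (divr_gt0 e0 C0)); apply: filterS => t.
  rewrite ltr_pdivlMr // mulrC; apply: le_lt_trans; apply: le_trans (hC (g t)).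
  rewrite [leRHS]/Num.Def.normr /= mx_normrE.
  exact: (le_bigmax _ (fun ij : 'I_1 * 'I_n => `|coord (g t) ij.1 ij.2|) (0, k)).
have -> : g = fun t => \sum_(i < nu | (j <= i)%N)
    \sum_k coord (g t) 0 k *: hg_proj i (b k).
  apply/funext => t; rewrite -{1}(hg_proj_sum (g t)) (bigID (fun i : 'I_nu => (j <= i)%N)) /=.
  rewrite [X in _ + X]big1 ?addr0 => [ |i]; last first.
    by rewrite -ltnNge => ij; rewrite dg.
  apply: eq_bigr => i _; rewrite {1}(hz (g t)) linear_sum; apply: eq_bigr => k _.
  by rewrite linearZ.
suff [] : small (fun t => \sum_(i < nu | (j <= i)%N)
    \sum_k coord (g t) 0 k *: hg_proj i (b k)) by [].
apply: small_sum => i ji; apply: small_sum => k _; split.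
- move=> t; apply: deepZ => l lj; rewrite (hg_proj_of_layer _ (hg_proj_layer i _)).
  by case: eqP => // li; move: lj; rewrite li ltnNge ji.
- apply: norm_gcvg; rewrite -(scale0r (hg_proj i (b k))).
  by apply: cvgZr_tmp; apply: cc.
- by apply: (gauge_layer_cvg0 (hg_proj_layer i _)); apply: cc.
Qed.

End Limits.

Lemma gauge_cvg0 (T : Type) (F : set_system T) {FF : Filter F} (g : T -> G) :
  g t @[t --> F] --> (0 : G) -> D (g t) @[t --> F] --> (0 : R).
Proof.
(* Here n counts the layers still allowed to be nonzero; for n = 0 the function g is 0. *)
suff h n : (n <= nu)%N -> forall T (F : set_system T) (FF : Filter F) (g : T -> G),
    (forall t, deep (nu - n) (g t)) ->
    g t @[t --> F] --> (0 : G) -> D (g t) @[t --> F] --> (0 : R).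
  by apply: (h nu) => // t; rewrite subnn.
elim: n => [_|n IH ltn] {}T {}F {}FF {}g dg cg.
  have -> : (fun t => D (g t)) = fun=> 0; last exact: cvg_cst.
  apply/funext => t; have := dg t; rewrite subn0 => /deep_eq0 ->.
  exact: gauge0.
apply: (gauge_step _ dg cg) => u du cu.
by apply: IH; rewrite ?(ltnW ltn) // -subSn ?subSS in du *.
Qed.

End Gauge.

(** Write [g t = l ** q t] with [q t = ldiv l (g t)] tending to 0; the gauge [hg_norm sigma (L x)]
    gives L(q t) -> 0, and L(g t) = L(l) L(q t). *)
Lemma h_homomorphism_gcvg (M : banachHomogeneousGroup R) sigma (L : G -> M)
    (T : Type) (F : set_system T) {FF : Filter F} (g : T -> G) l :
  norm_constants M sigma -> h_homomorphism L ->
  g t @[t --> F] --> l -> gcvg F (fun t => L (g t)) (L l).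
Proof.
move=> [s1 s0 sM] [Lmul Ldil] /norm_gcvg cg.
have sigma0 (i : 'I_(hg_step M)) : 0 < sigma i.+1 by apply: s0; rewrite /= ltn_ord.
have cq : ldiv l (g t) @[t --> F] --> (0 : G).
  by apply: gcvg_norm; rewrite -(ldivxx l); apply: gcvg_ldiv => //; apply: gcvg_cst.
have Lq : gcvg F (fun t => L (ldiv l (g t))) 0.
  apply/(gcvg0_norm sigma0).
  apply: (gauge_cvg0 (D := fun x => hg_norm sigma (L x)) _ _ _ cq).
  - by move=> x; apply: hg_norm_ge0.
  - by move=> x y; rewrite Lmul; apply: sM.
  - by move=> r x r0; rewrite Ldil // hg_norm_dilation.
have : gcvg F (fun t => L l ** L (ldiv l (g t))) (L l ** 0).
  by apply: gcvg_gmul => //; apply: gcvg_cst.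
by under eq_fun do rewrite -Lmul ldivK; rewrite gmul0.
Qed.

(** * The topology of a homogeneous distance *)

Section HomogeneousDistance.
Variable d : G -> G -> R.
Hypothesis hd : homogeneous_distance d.
Local Notation N := (@hg_norm R G (fun=> 1)).

Lemma hdist_mul0 x y : d (x ** y) x = d y 0.
Proof. by rewrite -{2}(gmul0 x) (hdist_left_invariant hd). Qed.

Lemma hdist_dilation0 r x : 0 < r -> d (dilation r x) 0 = r * d x 0.
Proof.
by move=> r0; rewrite -{1}(linear0 (dilation r)) (hdist_dilation hd).
Qed.

Lemma hdist_ldiv x y : d y x = d (ldiv x y) 0.
Proof. by rewrite -(hdist_mul0 x) ldivK. Qed.

Lemma norm_hdist_cvg (T : Type) (F : set_system T) {FF : Filter F} (g : T -> G) l :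
  g t @[t --> F] --> l -> d (g t) l @[t --> F] --> (0 : R).
Proof.
move=> /norm_gcvg cg.
have cq : ldiv l (g t) @[t --> F] --> (0 : G).
  by apply: gcvg_norm; rewrite -(ldivxx l); apply: gcvg_ldiv => //; apply: gcvg_cst.
under eq_fun do rewrite hdist_ldiv.
apply: (gauge_cvg0 (D := fun x => d x 0) _ _ _ cq).
- by move=> x; apply: hdist_ge0.
(* The triangle inequality passes through x, as d(xy, x) = d(y, 0) by left invariance. *)
- by move=> x y; rewrite addrC -(hdist_mul0 x y); apply: hdist_triangle.
- by move=> r x; apply: hdist_dilation0.
Qed.

Lemma hball_open x r : open (hball d x r).
Proof.
rewrite openE => y /= xy; rewrite /hball /= in xy.
have /cvgr0Pnorm_lt : d z y @[z --> y] --> (0 : R) by exact: norm_hdist_cvg.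
move=> /(_ (r - d x y)); rewrite subr_gt0 => /(_ xy).
apply: filterS => z; rewrite ger0_norm ?(hdist_ge0 hd) // => zy.
rewrite /hball /=; apply: le_lt_trans (hdist_triangle hd x y z) _.
by rewrite -ltrBrDl (hdist_sym hd).
Qed.

Let unit_pos (i : 'I_nu) : 0 < (1 : R).
Proof. exact: ltr01. Qed.

Lemma hg_norm_bound r (z : G) : 0 < r -> N z < r -> `|z| <= \sum_(i < nu) r ^+ i.+1.
Proof.
move=> r0 /(hg_norm_ltP (sigma := fun=> 1) unit_pos _ r0) h; rewrite -(hg_proj_sum z).
apply: le_trans (ler_norm_sum _ _ _) _; apply: ler_sum => i _.
by rewrite ltW // -(divr1 r) h.
Qed.

(** The continuous function d(., 0) is bounded below by a positive m on a compact set containing the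
    unit sphere of N and missing 0; homogeneity does the rest. *)
Lemma hdist_lower : exists2 m, 0 < m & forall z, m * N z <= d z 0.
Proof.
(* [hg_norm_bound] needs a strict bound, and N z = 1 < 2 on the unit sphere. *)
pose B := \sum_(i < nu) (2 : R) ^+ i.+1.
pose U := [set z : G | N z < 1].
have oU : open U.
  have UP z : U z <-> forall i : 'I_nu, `|hg_proj i z| < 1.
    rewrite /U /= (hg_norm_ltP (sigma := fun=> 1) unit_pos _ ltr01).
    by split=> h i; have := h i; rewrite divr1 expr1n.
  rewrite openE => z /UP Uz; apply: (filterS (fun y => (UP y).2)).
  apply: filter_forall => i; apply: open_nbhs_nbhs; split; last exact: Uz.
  apply: (open_comp (f := fun z : G => `|hg_proj i z|) (D := [set x | x < 1])).
    move=> y _; apply: (@continuous_comp _ _ _ (@hg_proj R G i) (@Num.Def.normr _ G)).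
      exact: hg_proj_continuous.
    exact: norm_continuous.
  exact: open_lt.
pose K := [set z : G | `|z| <= B] `&` ~` U.
have cK : compact K.
  apply: (@subclosed_compact _ _ [set z : G | `|z| <= B]).
  - apply: closedI; last by rewrite closedC.
    by apply: (closed_comp (f := fun c : G => `|c|) (D := [set x | x <= B]));
      [move=> c _; apply: norm_continuous|exact: closed_le].
  - exact: findim_bounded_compact.
  - by move=> z [].
have dc : continuous (fun z => d z 0).
  move=> z; apply/cvgrPdist_lt => e e0.
  have /cvgr0Pnorm_lt : d y z @[y --> z] --> (0 : R) by exact: norm_hdist_cvg.
  move=> /(_ _ e0); apply: filterS => y.
  rewrite ger0_norm ?(hdist_ge0 hd) //; apply: le_lt_trans.
  rewrite ler_norml lerBlDr lerNl opprB lerBlDr.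
  rewrite (hdist_triangle hd) /= (hdist_sym hd y z); exact: hdist_triangle.
have clK : closed ((fun z => d z 0) @` K).
  apply: compact_closed; first exact: norm_hausdorff.
  by apply: continuous_compact => //; apply: continuous_subspaceT.
have : open_nbhs 0 (~` ((fun z => d z 0) @` K)).
  split; first by rewrite openC.
  move=> [z [_ nUz]] /(hdist_eq0 hd) z0; apply: nUz; rewrite z0 /U /=.
  by apply/(hg_norm_ltP (sigma := fun=> 1) unit_pos _ ltr01) => i; rewrite linear0 normr0 divr1 expr1n.
move=> /open_nbhs_nbhs /nbhs_norm0P[m /= m0 hm]; exists m => // z.
have := hg_norm_ge0 (fun=> 1) z; rewrite le_eqVlt => /orP[/eqP <-|r0].
  by rewrite mulr0 (hdist_ge0 hd).
set r := N z in r0 *.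
have : ~ `|d (dilation r^-1 z) 0| < m.
  move=> /hm; apply; exists (dilation r^-1 z) => //.
  have Nz : N (dilation r^-1 z) = 1.
    by rewrite (hg_norm_dilation (sigma := fun=> 1) unit_pos) ?invr_gt0 // mulVf ?gt_eqF.
  split; last by rewrite /U /= Nz ltxx.
  by apply: hg_norm_bound; rewrite ?Nz ?ltr1n.
move=> /negP; rewrite -leNgt ger0_norm ?(hdist_ge0 hd) //.
by rewrite hdist_dilation0 ?invr_gt0 // ler_pdivlMl // mulrC.
Qed.

Lemma hdist_norm_cvg (T : Type) (F : set_system T) {FF : Filter F} (g : T -> G) l :
  d (g t) l @[t --> F] --> (0 : R) -> g t @[t --> F] --> l.
Proof.
move=> cd; have [m m0 hm] := hdist_lower; apply: gcvg_norm.
have cq : gcvg F (fun t => ldiv l (g t)) 0.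
  apply/(gcvg0_norm (sigma := fun=> 1) unit_pos).
  have le t : 0 <= N (ldiv l (g t)) <= m^-1 * d (g t) l.
    by rewrite hg_norm_ge0 ler_pdivlMl // hdist_ldiv hm.
  apply: (squeeze_cvgr (nearW _ le)); first exact: cvg_cst.
  by rewrite -(mulr0 m^-1); apply: cvgM => //; apply: cvg_cst.
have : gcvg F (fun t => l ** ldiv l (g t)) (l ** 0).
  by apply: gcvg_gmul => //; apply: gcvg_cst.
by under eq_fun do rewrite ldivK; rewrite gmul0.
Qed.

Lemma hdist_bounded r : exists B, forall z, d z 0 <= r -> `|z| <= B.
Proof.
have [m m0 hm] := hdist_lower.
(* N z <= d(z, 0) / m < |r| / m + 1; the absolute value keeps this positive for every r. *)
exists (\sum_(i < nu) (`|r| / m + 1) ^+ i.+1) => z zr.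
have s0 : 0 < `|r| / m + 1 by rewrite ltr_wpDl // divr_ge0 // ltW.
apply: hg_norm_bound => //; rewrite ltr_pwDr // ler_pdivlMr // mulrC.
by apply: le_trans (hm z) _; apply: le_trans zr _; apply: ler_norm.
Qed.

Lemma hdist_totally_bounded r e : 0 < e ->
  exists s : seq G, forall v, d v 0 <= r -> exists2 p, p \in s & d p v < e.
Proof.
move=> e0; have [B hB] := hdist_bounded r.
have := @findim_bounded_compact _ _ fd B; rewrite compact_cover.
move=> /(_ G setT (fun p => hball d p e)) [ |v _|D _ hD].
- by move=> p _; apply: hball_open.
- by exists v => //; rewrite /hball /= (hdist_eq0 hd v v).2.
exists (finmap.enum_fset D) => v /hB /hD[p pD vp]; exists p => //.
Qed.

End HomogeneousDistance.
End FiniteDimensionalGroup.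

(** * Density points and directional derivatives *)

Lemma near_right0P (R : realType) (P : R -> Prop) :
  (\forall t \near (0 : R)^'+, P t) <->
  exists2 delta, 0 < delta & forall t, 0 < t < delta -> P t.
Proof.
rewrite near_withinE; split=> [/nbhs_norm0P[r /= r0 h]|[r r0 h]].
  by exists r => // t /andP[t0 tr]; apply: h => //=; rewrite gtr0_norm.
exists r => //= t; rewrite /= sub0r normrN => tr t0; apply: h.
by rewrite t0 -(gtr0_norm t0).
Qed.

(** For use with b the measure of a ball, a that of its part in A, and s that of a smaller ball
    inside it which A misses. *)
Lemma fine_ratio_le (R : realType) (a b s : \bar R) n : (0 < n)%N ->
  (0 <= a)%E -> (0 <= s)%E -> (a + s <= b)%E -> (b <= n%:R%:E * s)%E ->
  fine a / fine b <= 1 - n%:R^-1.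
Proof.
move=> n0; have n1 : (0 : R) <= 1 - n%:R^-1.
  by rewrite subr_ge0 invf_le1 ?ltr0n // ler1n.
(* [fine] sends infinite values to 0 and the inverse of 0 is 0, so the ratio is then 0. *)
case: b => [b| | ]; last 2 first.
- by rewrite /= invr0 mulr0.
- by rewrite /= invr0 mulr0.
case: a => [a| | ] //; case: s => [s| | ] //.
rewrite !lee_fin /= => a0 s0 asb bns.
have [->|b0] := eqVneq b 0; first by rewrite invr0 mulr0.
have bpos : 0 < b by rewrite lt_neqAle eq_sym b0 (le_trans _ asb) // addr_ge0.
rewrite ler_pdivrMr // mulrBl mul1r lerBrDr (le_trans _ asb) // lerD2l.
by rewrite ler_pdivrMl ?ltr0n.
Qed.

Section Differentiation.
Context {R : realType} {G M : banachHomogeneousGroup R}.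
Hypothesis fd : exists n (b : 'I_n -> G), lin_span (range b) = setT.
Variable d : G -> G -> R.
Hypothesis hd : homogeneous_distance d.

(** By homogeneity the distance from the dilate to zeta equals d(z_t, delta_t zeta) / t. *)
Lemma approximates_dilation (A : set G) x zeta z : approximates d A x zeta z ->
  dilation t^-1 (z t) @[t --> (0 : R)^'+] --> zeta.
Proof.
move=> [_ cz]; apply: (hdist_norm_cvg fd hd).
move/cvgr0Pnorm_lt: cz => cz; apply/cvgr0Pnorm_lt => e /cz.
move=> /near_right0P[r r0 hr]; apply/near_right0P; exists r => // t tr.
have /andP[t0 _] := tr; have := hr t tr.
rewrite -{2}(dilationVK zeta (lt0r_neq0 t0)) (hdist_dilation hd) ?invr_gt0 //.
by rewrite mulrC.
Qed.

(** * Approximating points at a density point *)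

Section Density.
Variables (mu : {measure set (borel G) -> \bar R}) (A : set G) (x : G).
Hypothesis hmu : haar_measure mu.

Lemma hball_gmul p r : gmul p @` hball d 0 r = hball d p r.
Proof.
apply/seteqP; split=> [_ [v hv <-]|y hy]; rewrite /hball /=.
  by rewrite -{1}(gmul0 p) (hdist_left_invariant hd).
exists (ldiv p y); last exact: ldivK.
by rewrite /hball /= (hdist_sym hd) -(hdist_ldiv hd) (hdist_sym hd).
Qed.

Lemma haar_hball p r : (mu^*)%mu (hball d p r) = (mu^*)%mu (hball d 0 r).
Proof.
have mb q : measurable (hball d q r : set (borel G)).
  by apply: sub_sigma_algebra; apply: hball_open.
by rewrite !measurable_mu_extE // -hball_gmul (haar_left_invariant hmu).
Qed.

Lemma haar_hball_doubling r e : 0 < e -> exists2 n, (0 < n)%N &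
  forall y t, 0 < t -> ((mu^*)%mu (hball d y (r * t)) <=
    n%:R%:E * (mu^*)%mu (hball d 0%R (e * t)))%E.
Proof.
move=> e0; have [s hs] := hdist_totally_bounded fd hd r e0.
(* The additional ball, centred at y through the default value 0 of [nth], makes n positive even for
   empty s. *)
exists (size s).+1 => // y t t0.
pose F i := hball d (y ** dilation t (nth 0 s i)) (e * t).
apply: (@le_trans _ _ ((mu^*)%mu (\big[setU/set0]_(i < (size s).+1) F i))).
  apply: le_outer_measure => w; rewrite /hball /= => yw.
  pose v := dilation t^-1 (ldiv y w).
  have [ |p ps pv] := hs v.
    rewrite /v (hdist_dilation0 hd) ?invr_gt0 // -(hdist_ldiv hd) (hdist_sym hd).
    by rewrite ler_pdivrMl // mulrC ltW.
  rewrite -bigcup_mkord; exists (index p s).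
    by rewrite /= ltnS index_size.
  rewrite /F /hball /= nth_index // -{1}(ldivK y w).
  rewrite (hdist_left_invariant hd) -(dilationK (ldiv y w) (lt0r_neq0 t0)).
  by rewrite (hdist_dilation hd) // mulrC ltr_pM2r.
apply: le_trans (outer_measure_subadditive _ _ _) _.
rewrite (eq_bigr (fun=> (mu^*)%mu (hball d 0 (e * t)))); last first.
  by move=> i _; apply: haar_hball.
by rewrite sumr_const card_ord /= mule_natl.
Qed.

Hypothesis hA : ((mu^*)%mu).-caratheodory A.
Hypothesis hDx : density_point d A mu x.

(** If A missed the ball of radius e t at x delta_t(zeta), the density ratio at radius r t would be
    at most 1 - 1/n, with n from the covering bound. *)
Lemma density_near zeta e : 0 < e ->
  \forall t \near (0 : R)^'+, exists2 z, A (x ** z) & d z (dilation t zeta) < e * t.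
Proof.
(* By the triangle inequality the ball of radius r t at x contains the ball of radius e t at x
   delta_t(zeta). *)
move=> e0; pose r := d zeta 0 + e.
have r0 : 0 < r by rewrite ltr_wpDl // (hdist_ge0 hd).
have [n n0 hn] := haar_hball_doubling r e0.
move: hDx => /cvgrPdist_lt /(_ n%:R^-1); rewrite invr_gt0 ltr0n => /(_ n0).
move=> /near_right0P[rad rad0 hrad]; apply/near_right0P.
exists (rad / r) => [ |t /andP[t0 tr]]; first by rewrite divr_gt0.
apply: contrapT => hno.
have /hrad : 0 < r * t < rad by rewrite mulr_gt0 //= mulrC -ltr_pdivlMr.
apply/negP; rewrite -leNgt; apply: le_trans (ler_norm _); rewrite lerBrDr addrC -lerBrDr.
apply: (@fine_ratio_le _ _ _ ((mu^*)%mu (hball d (x ** dilation t zeta) (e * t))) n) => //.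
- exact: outer_measure_ge0.
- exact: outer_measure_ge0.
2: by rewrite (haar_hball (x ** dilation t zeta)) hn.
(* Caratheodory's condition splits the large ball along A; the small ball lies in the part outside
   A. *)
rewrite (hA (hball d x (r * t))) setIC leeD2l //; apply: le_outer_measure => y.
rewrite /hball /= => py; split.
  rewrite /hball /=; apply: le_lt_trans (hdist_triangle hd _ (x ** dilation t zeta) _) _.
  by rewrite (hdist_sym hd) (hdist_mul0 hd) (hdist_dilation0 hd) // /r mulrDl mulrC ltrD2l.
move=> Ay; apply: hno; exists (ldiv x y); first by rewrite ldivK.
by rewrite -(hdist_left_invariant hd _ _ x) ldivK (hdist_sym hd).
Qed.

Hypothesis hx : A x.

Lemma approximates_exists zeta : exists z, approximates d A x zeta z.
Proof.
pose E t := [set d z (dilation t zeta) | z in [set z | A (x ** z)] ].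
have Einf t : has_inf (E t).
  split; first by exists (d 0 (dilation t zeta)), 0 => //=; rewrite gmul0.
  by exists 0 => _ [z _ <-]; apply: hdist_ge0.
(* The infimum may not be attained, and an error t * t is o(t). For t <= 0 the point 0 is a default
   value, admissible since x is in A. *)
have /choice[z hz] : forall t, exists z, A (x ** z) /\
    (0 < t -> d z (dilation t zeta) < inf (E t) + t * t).
  move=> t; have [t0|t0] := ltP 0 t.
    by have [_ [z Az <-] lt] := inf_adherent (mulr_gt0 t0 t0) (Einf t); exists z.
  by exists 0; rewrite gmul0.
exists z; split=> [t _| ]; first by have [] := hz t.
apply/cvgr0Pnorm_lt => e e0; near=> t.
have t0 : 0 < t by near: t; apply: nbhs_right_gt.
have [w Aw hw] : exists2 z, A (x ** z) & d z (dilation t zeta) < e / 2 * t.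
  by near: t; apply: density_near; rewrite divr_gt0.
have te : t < e / 2 by near: t; apply: nbhs_right_lt; rewrite divr_gt0.
rewrite ger0_norm ?divr_ge0 ?(hdist_ge0 hd) ?(ltW t0) // ltr_pdivrMr //.
apply: lt_trans ((hz t).2 t0) _; rewrite [e]splitr mulrDl ltrD // ?ltr_pM2r //.
apply: le_lt_trans hw; apply: ge_inf; first by case: (Einf t).
by exists w.
Unshelve. all: by end_near. Qed.

End Density.

(** * Differentials and directional derivatives *)

Variable sigma : nat -> R.
Hypothesis hsigma : norm_constants M sigma.

Let sigma_gt0 (i : 'I_(hg_step M)) : 0 < sigma i.+1.
Proof. by case: hsigma => _ s0 _; apply: s0; rewrite /= ltn_ord. Qed.

Lemma hg_dist_xx (y : M) : hg_dist sigma y y = 0.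
Proof.
by rewrite hg_distE gmulVg (gauge0 (D := hg_norm sigma)) // => r z;
   apply: hg_norm_dilation.
Qed.

Lemma h_homomorphism0 (L : G -> M) : h_homomorphism L -> L 0 = 0.
Proof. by move=> [Lm _]; apply: (@gmul_injl _ _ (L 0)); rewrite -Lm !gmul0. Qed.

Variables (A : set G) (f : G -> M) (x : G).
Local Notation incr z := (ginv (f x) ** f (x ** z)).

Lemma is_dir_derivative_unique zeta l l' :
  is_dir_derivative d sigma A f x zeta l ->
  is_dir_derivative d sigma A f x zeta l' -> l = l'.
Proof.
move=> [[z hz] h] [_ h'].
have c k : (hg_dist sigma (dilation t^-1 (incr (z t))) k @[t --> 0^'+] --> (0 : R)) ->
    gcvg (0 : R)^'+ (fun t => dilation t^-1 (incr (z t))) k.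
  move=> /(cvg_hg_dist (h := fun=> k) (l := k) sigma_gt0); apply; exact: gcvg_cst.
exact: gcvg_unique (c _ (h z hz)) (c _ (h' z hz)).
Qed.

Lemma dir_derivativeE zeta l : is_dir_derivative d sigma A f x zeta l ->
  dir_derivative d sigma A f x zeta = l.
Proof.
move=> hl; apply: (is_dir_derivative_unique (zeta := zeta)) (hl).
have := @xgetPex _ (0 : M) [set l | is_dir_derivative d sigma A f x zeta l].
by apply; exists l.
Qed.

Lemma h_differential_is_dir_derivative (L : G -> M) zeta :
  h_homomorphism L ->
  (forall e : R, 0 < e -> exists2 delta : R, 0 < delta &
     forall z, A (x ** z) -> 0 < d z 0 < delta ->
       hg_dist sigma (incr z) (L z) / d z 0 < e) ->
  (exists z, approximates d A x zeta z) ->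
  is_dir_derivative d sigma A f x zeta (L zeta).
Proof.
move=> hL hf ex; split=> // z hz; have cw := approximates_dilation hz.
have cL : gcvg (0 : R)^'+ (fun t => L (dilation t^-1 (z t))) (L zeta).
  exact: (h_homomorphism_gcvg fd hsigma hL cw).
suff cu : hg_dist sigma (dilation t^-1 (incr (z t))) (L (dilation t^-1 (z t)))
    @[t --> 0^'+] --> (0 : R).
  apply: (hg_dist_cvg sigma_gt0 (l := L zeta)); last exact: gcvg_cst.
  exact: (cvg_hg_dist sigma_gt0 cu cL).
(* Eventually delta_{1/t} z_t is within 1 of zeta, so d(z_t, 0) < t K. *)
apply/cvgr0Pnorm_lt => e e0; pose K := d zeta 0 + 1.
have K0 : 0 < K by rewrite ltr_wpDl // (hdist_ge0 hd).
have [delta delta0 hdelta] := hf _ (divr_gt0 e0 K0); near=> t.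
have t0 : 0 < t by near: t; apply: nbhs_right_gt.
have td : t < delta / K by near: t; apply: nbhs_right_lt; rewrite divr_gt0.
have wK : d (z t) 0 < t * K.
  have : d (dilation t^-1 (z t)) zeta < 1.
    near: t; have /cvgr0Pnorm_lt/(_ _ ltr01) :
        d (dilation t^-1 (z t)) zeta @[t --> 0^'+] --> (0 : R).
      exact: (norm_hdist_cvg fd hd cw).
    by apply: filterS => t; rewrite ger0_norm // (hdist_ge0 hd).
  move=> w1; rewrite -ltr_pdivrMl // -(hdist_dilation0 hd) ?invr_gt0 //.
  by apply: le_lt_trans (hdist_triangle hd _ zeta _) _; rewrite addrC ltrD2l.
rewrite ger0_norm ?hg_dist_ge0 // hL.2 ?invr_gt0 // hg_dist_dilation ?invr_gt0 //.
rewrite mulrC ltr_pdivrMr //.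
(* At z_t = 0, excluded from the estimate of differentiability, both the increment and L vanish. *)
have := hdist_ge0 hd (z t) 0; rewrite le_eqVlt => /orP[/eqP/esym/(hdist_eq0 hd) ->|zt0].
  by rewrite gmul0 gmulVg h_homomorphism0 // hg_dist_xx mulr_gt0.
have tK : t * K < delta by rewrite -ltr_pdivlMr.
have := hdelta (z t) (hz.1 t t0); rewrite zt0 (lt_trans wK tK) => /(_ isT).
rewrite ltr_pdivrMr // => /lt_trans; apply.
have -> : e * t = e / K * (t * K) by rewrite mulrACA mulVf ?mulr1 // gt_eqF.
by rewrite ltr_pM2l // divr_gt0.
Unshelve. all: by end_near. Qed.

Lemma dir_derivative_h_differential (L : G -> M) :
  h_homomorphism L ->
  (forall zeta, zeta <> 0 -> is_dir_derivative d sigma A f x zeta (L zeta)) ->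
  forall e : R, 0 < e -> exists2 delta : R, 0 < delta &
    forall z, A (x ** z) -> 0 < d z 0 < delta ->
      hg_dist sigma (incr z) (L z) / d z 0 < e.
Proof.
move=> hL hder e e0; apply: contrapT => hno.
have bad delta : 0 < delta -> exists z, [/\ A (x ** z), 0 < d z 0 < delta &
    e <= hg_dist sigma (incr z) (L z) / d z 0].
  move=> delta0; apply: contrapT => hz; apply: hno; exists delta => // z Az dz.
  by rewrite ltNge; apply/negP => le; apply: hz; exists z.
have /choice[zn hzn] : forall n : nat, exists z, [/\ A (x ** z),
    0 < d z 0 < n.+1%:R^-1 & e <= hg_dist sigma (incr z) (L z) / d z 0].
  by move=> n; apply: bad; rewrite invr_gt0.
pose w n := dilation (d (zn n) 0)^-1 (zn n).
have zn0 n : 0 < d (zn n) 0 by have [_ /andP[]] := hzn n.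
have w1 n : d (w n) 0 = 1.
  by rewrite (hdist_dilation0 hd) ?invr_gt0 // mulVf // gt_eqF.
have [B hB] := hdist_bounded fd hd 1.
have [zeta [_ clw]] : exists zeta, ([set z : G | `|z| <= B] `&` cluster (w @ \oo)) zeta.
  apply: (findim_bounded_compact fd); exists 0%N => // n _ /=.
  by apply: hB; rewrite w1.
have /choice[phi hphi] : forall k : nat, exists n, (k <= n)%N /\ d (w n) zeta < k.+1%:R^-1.
  move=> k; have [ | |_ [[n kn <-]]] := clw [set w n | n in [set n | (k <= n)%N] ]
      (hball d zeta k.+1%:R^-1).
  - by exists k => // n kn; exists n.
  - apply: open_nbhs_nbhs; split; first exact: (hball_open fd hd).
    by rewrite /hball /= (hdist_eq0 hd _ _).2 // invr_gt0.
  by rewrite /hball /= (hdist_sym hd) => dw; exists n.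
(* For k = 0 the selected w is at distance less than 1 from zeta, but at distance exactly 1 from
   0. *)
have zeta0 : zeta <> 0.
  by move=> z0; have [_] := hphi 0%N; rewrite z0 w1 invr1 ltxx.
pose s k := d (zn (phi k)) 0.
have s0 k : 0 < s k by apply: zn0.
have cs : s k @[k --> \oo] --> (0 : R).
  have le k : 0 <= s k <= k.+1%:R^-1.
    rewrite ltW //=; have [kp _] := hphi k; have [_ /andP[_ /ltW le] _] := hzn (phi k).
    by apply: le_trans le _; rewrite lef_pV2 ?posrE // ler_nat.
  apply: (squeeze_cvgr (nearW _ le)); [exact: cvg_cst|exact: cvg_harmonic].
have [[c0 [Ac0 hc0]] _] := hder _ zeta0.
(* The curve passes through a bad point at each time [s k] and follows the given approximating curve
   [c0] at all other times. *)
have /choice[c hc] : forall t, exists v,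
    (exists2 k, s k = t & v = zn (phi k)) \/ ((forall k, s k <> t) /\ v = c0 t).
  move=> t; have [[k sk]|nk] := pselect (exists k, s k = t).
    by exists (zn (phi k)); left; exists k.
  by exists (c0 t); right; split=> // k sk; apply: nk; exists k.
(* As s may repeat values, the bad point at time [s k] may carry another index k'. *)
have hcs k : exists k', c (s k) = zn (phi k') /\ s k' = s k.
  by case: (hc (s k)) => [[k' ek ->]|[/(_ k)]//]; exists k'.
have ac : approximates d A x zeta c.
  split=> [t t0| ].
    by case: (hc t) => [[k _ ->]|[_ ->]]; [have [] := hzn (phi k)|apply: Ac0].
  apply/cvgr0Pnorm_lt => eps eps0.
  have [N _ hN] := near_infty_natSinv_lt (PosNum eps0); near=> t.
  have t0 : 0 < t by near: t; apply: nbhs_right_gt.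
  case: (hc t) => [[k skt ->]|[_ ->]]; last first.
    by near: t; move/cvgr0Pnorm_lt: hc0; apply.
  (* Times [s k] with k < N are finitely many and positive, so small t avoids them; for k >= N the
     point is within 1/(k+1) < eps of the direction after rescaling. *)
  have [kN|Nk] := ltnP k N.
    have : forall j : 'I_N, t < s j.
      by near: t; apply: filter_forall => j; apply: nbhs_right_lt.
    by move=> /(_ (Ordinal kN)); rewrite /= skt ltxx.
  have [_ hk] := hphi k; apply: le_lt_trans (lt_trans hk (hN k Nk)).
  rewrite ger0_norm ?divr_ge0 ?(hdist_ge0 hd) ?(ltW t0) // ler_pdivrMr // mulrC.
  by rewrite -(hdist_dilation hd) // /w -/(s k) skt dilationK ?gt_eqF.
have [_ /(_ c ac) hlim] := hder _ zeta0.
have along (h : R -> R) : h t @[t --> 0^'+] --> (0 : R) ->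
    h (s k) @[k --> \oo] --> (0 : R).
  by move=> hh; apply: ((cvg_at_rightP h 0 0).1 hh s).
pose v k := dilation (s k)^-1 (c (s k)).
have cv : v k @[k --> \oo] --> zeta.
  apply: (hdist_norm_cvg fd hd); apply: (along (fun t => d (dilation t^-1 (c t)) zeta)).
  exact: (norm_hdist_cvg fd hd (approximates_dilation ac)).
have cLv : gcvg \oo (fun k => L (v k)) (L zeta).
  exact: (h_homomorphism_gcvg fd hsigma hL cv).
pose u k := dilation (s k)^-1 (incr (c (s k))).
have cu : gcvg \oo u (L zeta).
  have cst : gcvg \oo (fun=> L zeta) (L zeta) by apply: gcvg_cst.
  by apply: (cvg_hg_dist sigma_gt0 _ cst); apply: (along _ hlim).
(* Along s the rescaled increments and their images under L both tend to L(zeta), against the lower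
   bound e at the bad points. *)
have /cvgr0Pnorm_lt/(_ e e0)/filter_ex[k] :
    hg_dist sigma (u k) (L (v k)) @[k --> \oo] --> (0 : R).
  exact: (hg_dist_cvg sigma_gt0 cu cLv).
have [k' [ck sk]] := hcs k; have [_ _] := hzn (phi k').
rewrite -/(s k') sk -ck mulrC ger0_norm ?hg_dist_ge0 // /u /v.
by rewrite hL.2 ?invr_gt0 // hg_dist_dilation ?invr_gt0 // leNgt => /negP.
Unshelve. all: by end_near. Qed.

End Differentiation.

Theorem theorem1p3 (R : realType)
  (G : banachHomogeneousGroup R) (hG : stratified G)
  (d : G -> G -> R) (hd : homogeneous_distance d)
  (M : banachHomogeneousGroup R)
  (sigma : nat -> R) (hsigma : norm_constants M sigma)
  (mu : {measure set (borel G) -> \bar R}) (hmu : haar_measure mu)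
  (A : set G) (hA : ((mu^*)%mu).-caratheodory A)
  (f : G -> M) (hf : lipschitz_map d sigma A f)
  (x : G) (hx : A x) (hDx : density_point d A mu x) :
  h_differentiable d sigma A f x <->
  (forall zeta : G, zeta <> 0 -> dir_differentiable d sigma A f x zeta) /\
  h_homomorphism (dir_derivative d sigma A f x).
Proof.
have fd := stratified_findim hG; split.
  move=> [L hL hLd].
  (* This includes zeta = 0, so that the map of directional derivatives equals L on the whole
     group. *)
  have key zeta : is_dir_derivative d sigma A f x zeta (L zeta).
    apply: (h_differential_is_dir_derivative fd hd hsigma hL hLd).
    exact: (approximates_exists fd hd hmu hA hDx hx).
  split=> [zeta _| ]; first by exists (L zeta).
  have -> // : dir_derivative d sigma A f x = L.
  by apply/funext => zeta; apply: (dir_derivativeE hsigma (key zeta)).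
move=> [hdir hL]; exists (dir_derivative d sigma A f x) => //.
apply: (dir_derivative_h_differential fd hd hsigma hL) => zeta /hdir.
exact: xgetPex.
Qed.
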